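(* Let $n,k,r$ be integers with $n \ge n_{k,r} \ge k \ge 4r \ge 12$. If $\mathcal H$ is an $n$-vertex $2$-connected $r$-uniform hypergraph with no Berge cycle of length $k$ or longer, then $$|E(\mathcal H)| \le f(n,k,r,\lfloor (k-1)/2\rfloor) = f^*(n,k,r,\lfloor (k-1)/2\rfloor).$$
   Context: Hypergraphs have no multiple edges. A Berge cycle of length $\ell$ in a hypergraph is a set of $\ell$ distinct vertices $\{v_1,\dots,v_\ell\}$ and $\ell$ distinct edges $\{e_1,\dots,e_\ell\}$ such that $\{v_i,v_{i+1}\}\subseteq e_i$ with indices taken modulo $\ell$. The incidence bigraph of $\mathcal H$ is the bipartite graph with parts $E(\mathcal H)$ and $V(\mathcal H)$ in which an edge $a$ of $\mathcal H$ is adjacent to a vertex $y$ iff $y\in a$. The hypergraph $\mathcal H$ is $2$-connected if its incidence bigraph is a $2$-connected graph. Define $$f(n,k,r,a) := \binom{k-a}{\min\{r,\lfloor\frac{k-a}{2}\rfloor\}} + (n-k+a)\binom{a}{\min\{r-1,\lfloor a/2\rfloor\}},$$ $$f^*(n,k,r,a) := \binom{k-a}{r} + (n-k+a)\binom{a}{r-1}.$$ For integers $k\ge r$, $n_{k,r}$ is the smallest positive integer $n$ such that $f(n,k,r,\lfloor (k-1)/2\rfloor)\ge f(n,k,r,2)$. *)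

(* Defs.v *)
From mathcomp Require Import all_boot all_order all_algebra.

Set Implicit Arguments.
Unset Strict Implicit.
Unset Printing Implicit Defensive.

Import Order.TTheory GRing.Theory Num.Theory.

(* A simple graph is an adjacency relation [g] on a finite type [V]. *)

Definition connected_on (V : finType) (g : rel V) (A : {set V}) : Prop :=
  forall x y : V, x \in A -> y \in A ->
    connect [rel u w | [&& u \in A, w \in A & g u w]] x y.

Definition graph_connected (c : nat) (V : finType) (g : rel V) : Prop :=
  c < #|V| /\ forall X : {set V}, #|X| < c -> connected_on g (~: X).

(* A hypergraph without multiple edges on the vertex set [T] is given by its
   edge set [H : {set {set T}}]. *)

Definition uniform (T : finType) (r : nat) (H : {set {set T}}) : Prop :=
  forall e : {set T}, e \in H -> #|e| = r.

Definition incidence (T : finType) (H : {set {set T}}) :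
    rel ({e : {set T} | e \in H} + T) :=
  fun p q =>
    match p, q with
    | inl e, inr y => y \in val e
    | inr y, inl e => y \in val e
    | _, _ => false
    end.

Definition two_connected (T : finType) (H : {set {set T}}) : Prop :=
  graph_connected 2 (@incidence T H).

(* [ordS] is the cyclic successor on ['I_l]. *)
Definition berge_cycle (T : finType) (H : {set {set T}}) (l : nat)
    (v : 'I_l -> T) (e : 'I_l -> {set T}) : Prop :=
  [/\ injective v, injective e, forall i, e i \in H
    & forall i, [set v i; v (ordS i)] \subset e i].

Definition has_berge_cycle (T : finType) (H : {set {set T}}) (l : nat) : Prop :=
  exists (v : 'I_l -> T) (e : 'I_l -> {set T}), berge_cycle H v e.

Local Open Scope ring_scope.

(* Integer-valued: the factor [n - k + a] is negative for small [n], and such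
   [n] are in the range of the minimum [is_n_kr]. *)
Definition f (n k r a : nat) : int :=
  'C(k - a, minn r (k - a)./2)%:Z
  + (n%:Z - k%:Z + a%:Z) * 'C(a, minn (r - 1) a./2)%:Z.

Definition fstar (n k r a : nat) : int :=
  'C(k - a, r)%:Z + (n%:Z - k%:Z + a%:Z) * 'C(a, r - 1)%:Z.

Definition is_n_kr (k r m : nat) : Prop :=
  [/\ (0 < m)%N,
      f m k r 2 <= f m k r (k - 1)./2
    & forall m' : nat, (0 < m')%N ->
        f m' k r 2 <= f m' k r (k - 1)./2 -> (m <= m')%N].

(* Main.v *)
Require Import Defs.
From mathcomp Require Import all_boot all_order all_algebra.
From mathcomp Require Import zify ring.
From Stdlib Require Import Classical.

Import Order.TTheory GRing.Theory Num.Theory.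
Set Implicit Arguments.
Unset Strict Implicit.
Unset Printing Implicit Defensive.

(** Why the theorem is true.

    The proof works with a family b of hyperedges on a vertex set U, indexed by
    a type I, whose incidence graph is 2-connected and which has no Berge cycle
    of length k or more, and with a set F of indices whose hyperedges form an
    antichain of sets of size at most r.  Only the members of F are counted;
    the other hyperedges are kept for 2-connectedness.  The claim, proved in
    [sperner_hypergraph_bound], is that for some a with 2 <= a <= (k - 1)/2,
      |F| <= A_r(k - a) + (|U| - k + a) A_{r-1}(a),
    where A_s(m), [antichain_bound s m], is the largest size of an antichain of
    sets of at most s points of an m-set.  The right-hand side is f(|U|, k, r, a).
    It is convex in a, so it is at most the larger of its values at a = 2 and at
    a = (k - 1)/2; the second one is at least as large from n_{k,r} on, because
    the coefficient of n in f does not decrease with a.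

    Allowing smaller sets makes induction possible: deleting a point v from a
    hyperedge e creates no new Berge cycle.  The deletion is unavailable only if
    e - v lies in another counted hyperedge (v is [covered] in e), or if 2-connectedness
    is lost; then a node c of the incidence graph [separates] v from the rest of e in
    the graph without e (v is essential in e).

    (1) Suppose that in every hyperedge with at least three points all points
    are covered.  Then every pair inside a hyperedge e lies in at least |e| - 1
    hyperedges, while a long cycle of the shadow graph uses at most |e| - 1
    pairs inside e.  By Hall's theorem a cycle of the shadow graph of length k
    or more lifts to a Berge cycle, so the shadow graph is a 2-connected graph
    without long cycles in which the hyperedges are cliques
    ([shadow_no_long_cycle]).  For such graphs the bound is proved by Kopylov's
    method ([kopylov]): in an edge-maximal graph, either vertices of degree at
    most a can be deleted one by one until k - a vertices are left, each
    deletion costing at most A_{r-1}(a) cliques ([peeling]), or a path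
    between two nonadjacent vertices, each with many neighbours on that path,
    closes up to a long cycle by the lemma of Posa ([posa_cycle]).

    (2) Otherwise some hyperedge e with m >= 3 points has an uncovered point.
    Then all points of e but at most one are essential ([cut_system_exists]):
    e is attached to different branches of the rest of the graph.  Such a
    hyperedge can be contracted.  Identifying m - 1 essential points of e (e becomes
    a pair) preserves 2-connectedness ([contract_biconnected]) and creates no
    long Berge cycle, since a cycle through the new point lifts
    to a cycle that may in addition run through e ([contract_no_long_berge]).
    The antichain condition can fail for the images, but dropping at most one
    counted hyperedge for each identified point restores it ([collision]).  So m - 2
    vertices and at most m - 1 counted hyperedges are lost, and induction applies
    as the bound drops by at least 2(m - 2).  If fewer than k vertices would remain,
    identifying all of e leaves so few points that the antichain bound alone
    suffices ([count_full_contraction]). *)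

(** * Antichains of small sets *)

(** By unimodality this is the largest of the binomial coefficients C(n, i) with
    i <= s, and the largest antichain of sets of at most s points of an n-set is
    formed by all sets of the optimal size. *)
Definition antichain_bound (s n : nat) : nat := 'C(n, minn s n./2).

Lemma leq_bin_half n i j : i <= j -> j <= n./2 -> 'C(n, i) <= 'C(n, j).
Proof.
move=> le_ij le_jn.
have := subnKC le_ij; move: (j - i) => d.
elim: d j le_ij le_jn => [|d IHd] j le_ij le_jn; first by rewrite addn0 => ->.
move=> def_j; have := IHd (i + d) ltac:(lia) ltac:(lia) erefl.
move/leq_trans; apply; rewrite -def_j addnS.
have := mul_bin_left n (i + d).
have : (i + d).+1 <= n - (i + d) by lia.
move: ('C(n, i + d)) ('C(n, (i + d).+1)) => x y. nia.
Qed.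

Lemma bin_le_antichain_bound s n i :
  i <= s -> i <= n -> 'C(n, i) <= antichain_bound s n.
Proof.
move=> le_is le_in; rewrite /antichain_bound.
case: (leqP i n./2) => hi; first by apply: leq_bin_half; lia.
rewrite -bin_sub //; apply: leq_bin_half; lia.
Qed.

Lemma antichain_boundS s n : antichain_bound s n <= antichain_bound s n.+1.
Proof.
apply: (@leq_trans 'C(n.+1, minn s n./2)).
  by rewrite /antichain_bound; case: (minn s n./2) => [|i]; rewrite ?bin0 // binS leq_addr.
apply: bin_le_antichain_bound; lia.
Qed.

Lemma leq_antichain_bound s m n :
  m <= n -> antichain_bound s m <= antichain_bound s n.
Proof.
move=> /subnKC <-; elim: (n - m) => [|d IHd]; first by rewrite addn0.
by rewrite addnS (leq_trans IHd) // antichain_boundS.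
Qed.

Definition antichain (T : finType) (F : {set {set T}}) : Prop :=
  {in F &, forall A B : {set T}, A \subset B -> A = B}.

Section Lym.
Local Open Scope ring_scope.

(** Averaging over deleted points.  A member A other than S survives in S - x
    for the |S| - |A| points x of S outside A, and
    (|S| - |A|) / (|S| C(|S| - 1, |A|)) = 1 / C(|S|, |A|); so the sum for S is
    the mean of the sums for the sets S - x, each at most 1 by induction. *)
Lemma lym_inequality (T : finType) (S : {set T}) (F : {set {set T}}) :
    antichain F -> (forall A, A \in F -> A \subset S) ->
  \sum_(A in F) ('C(#|S|, #|A|)%:R)^-1 <= 1 :> rat.
Proof.
have [n le_n] := ubnP #|S|; elim: n => // n IHn in S F le_n *.
move=> acF subF.
case: (boolP (S \in F)) => [SF | SnF].
  rewrite (_ : F = [set S]); first by rewrite big_set1 binn invr1.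
  apply/setP=> A; rewrite inE; apply/idP/eqP => [AF|-> //].
  exact: acF (subF _ AF).
have [->|[A0 A0F]] := set_0Vmem F; first by rewrite big_set0.
have S_gt0 : (0 < #|S|)%N.
  rewrite lt0n cards_eq0; apply: contraNneq SnF => S0.
  by have := subF _ A0F; rewrite S0 subset0 => /eqP <-.
have nS : #|S|%:R != 0 :> rat by rewrite pnatr_eq0 -lt0n.
pose G x := [set A in F | x \notin A].
have bound x : x \in S -> \sum_(A in G x) ('C(#|S|.-1, #|A|)%:R)^-1 <= 1 :> rat.
  move=> xS; have cardSx : #|S :\ x| = #|S|.-1 by rewrite (cardsD1 x S) xS.
  rewrite -cardSx; apply: IHn.
  - by rewrite cardSx; lia.
  - move=> A B; rewrite !inE => /andP[AF _] /andP[BF _]; exact: acF.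
  - by move=> A; rewrite inE => /andP[/subF AS xA]; rewrite subsetD1 AS.
have key A : A \in F ->
  ('C(#|S|, #|A|)%:R)^-1 = #|S|%:R^-1 * \sum_(x in S | x \notin A) ('C(#|S|.-1, #|A|)%:R)^-1 :> rat.
  move=> AF; have AS := subF _ AF.
  have ltA : (#|A| < #|S|)%N.
    by apply: proper_card; rewrite properEneq AS andbT; apply: contraNneq SnF => <-.
  rewrite (eq_bigl [in S :\: A]) => [|x]; last by rewrite !inE andbC.
  rewrite sumr_const (cardsDS AS).
  have := mul_bin_down #|S| #|A|.
  move/(congr1 (GRing.natmul (1 : rat))); rewrite !natrM => Eb.
  have nb : 'C(#|S|, #|A|)%:R != 0 :> rat by rewrite pnatr_eq0 -lt0n bin_gt0 ltnW.
  have nb' : 'C(#|S|.-1, #|A|)%:R != 0 :> rat by rewrite pnatr_eq0 -lt0n bin_gt0; lia.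
  rewrite -[_^-1 *+ _]mulr_natr -[(#|S| - #|A|)%N%:R](mulfK nb) -Eb.
  by field; rewrite nS nb nb'.
rewrite (eq_bigr _ key) -mulr_sumr (exchange_big_dep [in S]) /=; last by move=> A x _ /andP[].
rewrite mulrC ler_pdivrMr ?mul1r ?ltr0n //.
apply: (@le_trans _ _ (\sum_(x in S) 1)); last by rewrite sumr_const.
apply: ler_sum => x xS; apply: le_trans (bound x xS).
rewrite le_eqVlt; apply/orP; left; apply/eqP; apply: eq_bigl => A.
by rewrite !inE xS.
Qed.

End Lym.

Lemma sperner (T : finType) (S : {set T}) (F : {set {set T}}) s :
    antichain F -> (forall A, A \in F -> A \subset S) ->
    (forall A, A \in F -> #|A| <= s) ->
  #|F| <= antichain_bound s #|S|.
Proof.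
move=> acF subF leF; have := lym_inequality acF subF.
have ab_gt0 : 0 < antichain_bound s #|S| by rewrite bin_gt0; lia.
move=> lym; rewrite -(ler_nat rat).
rewrite -[X in (_ <= X)%R]mul1r -ler_pdivrMr ?ltr0n //.
apply: le_trans lym; rewrite mulrC mulr_natr -sumr_const.
apply: ler_sum => A AF; rewrite lef_pV2 ?posrE ?ltr0n ?ler_nat //.
  by apply: bin_le_antichain_bound; [apply: leF|apply: subset_leq_card (subF _ AF)].
by rewrite bin_gt0 subset_leq_card ?subF.
Qed.

(** * Connectivity and disjoint paths *)

Section Connectivity.
Variables (V : finType) (g : rel V).
Implicit Types (A S : {set V}) (x y z : V).

Definition restr A : rel V := [rel u w | [&& u \in A, w \in A & g u w]].

(** Reachability is mostly used through sets that are closed under steps, which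
    avoids the manipulation of explicit paths. *)
Lemma connect_ind_set A S x y :
    connect (restr A) x y -> x \in S ->
    (forall u w, u \in S -> w \in A -> g u w -> w \in S) -> y \in S.
Proof.
case/connectP=> p; elim: p x => [|z p IHp] x /=; first by move=> _ ->.
case/andP=> /and3P[_ zA gxz] pz lastp xS closedS.
exact: IHp pz lastp (closedS _ _ xS zA gxz) closedS.
Qed.

Lemma connect_restr_last A x y : connect (restr A) x y -> y = x \/ y \in A.
Proof.
move=> cxy; have : y \in x |: A.
  by apply: (connect_ind_set cxy); rewrite ?setU11 // => u w _ wA _; rewrite setU1r.
by case/setU1P; [left | right].
Qed.

Lemma connect_restrS A S x y :
  A \subset S -> connect (restr A) x y -> connect (restr S) x y.
Proof.
move=> sAS; apply: connect_sub => u w /= /and3P[uA wA guw].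
by apply: connect1; apply/and3P; split=> //; apply: (subsetP sAS).
Qed.

Lemma connect_step A x y z :
  connect (restr A) x y -> y \in A -> z \in A -> g y z -> connect (restr A) x z.
Proof. by move=> cxy yA zA gyz; apply: connect_trans cxy (connect1 _); apply/and3P. Qed.

Lemma connect_restr_path A x y :
    connect (restr A) x y ->
  exists2 p, path g x p & [/\ last x p = y, uniq (x :: p) & {subset p <= A}].
Proof.
case/connectP=> p pp ->; case/shortenP: pp => q qq uq _; exists q.
  by apply: sub_path qq => u w /and3P[].
split=> //; elim: q x qq {uq} => [|z q IHq] x //= /andP[/and3P[_ zA _] /IHq sub] t.
by rewrite inE => /predU1P[-> //|/sub].
Qed.

Hypothesis gsym : symmetric g.

Lemma connect_restr_sym A : connect_sym (restr A).
Proof. by apply: sym_connect_sym => u w; rewrite /restr /= gsym andbCA. Qed.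

End Connectivity.

Lemma uniq_catI (T : eqType) (s1 s2 : seq T) :
  uniq s1 -> uniq s2 -> (forall z, z \in s1 -> z \notin s2) -> uniq (s1 ++ s2).
Proof.
move=> u1 u2 d; rewrite cat_uniq u1 u2 andbT /=.
by apply/hasPn => z z2; apply/negP => /d; rewrite z2.
Qed.

Lemma card_set_filter (T : finType) (s : seq T) (a : pred T) :
  uniq s -> #|[set z in s | a z]| = count a s.
Proof.
move=> us; rewrite -size_filter -(card_uniqP (filter_uniq a us)).
by apply: eq_card => z; rewrite !inE mem_filter andbC.
Qed.

Lemma split_first (T : eqType) (a : pred T) (s : seq T) :
  has a s -> exists s1 z s2, [/\ s = s1 ++ z :: s2, a z & forall t, t \in s1 -> ~~ a t].
Proof.
elim: s => //= z s IHs; have [az _|naz /= /IHs[s1 [w [s2 [-> aw h]]]]] := boolP (a z).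
  by exists [::], z, s.
exists (z :: s1), w, s2; split=> // t; rewrite inE => /predU1P[->//|]; exact: h.
Qed.

Lemma split_last (T : eqType) (a : pred T) (s : seq T) :
  has a s -> exists s1 z s2, [/\ s = s1 ++ z :: s2, a z & forall t, t \in s2 -> ~~ a t].
Proof.
rewrite -has_rev => /split_first[s1 [z [s2 [def_s az h]]]].
exists (rev s2), z, (rev s1); split=> // [|t]; last by rewrite mem_rev; apply: h.
by rewrite -[s]revK def_s rev_cat rev_cons cat_rcons.
Qed.


Lemma not_sorted_step (T : eqType) (e : rel T) s :
  ~~ sorted e s -> exists l u v r, s = l ++ u :: v :: r /\ ~~ e u v.
Proof.
case: s => //= z q; elim: q z => //= t q IHq z.
have [ezt /= |nezt _] := boolP (e z t); last by exists [::], z, t, q.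
by case/IHq=> l [u [v [r [-> euv]]]]; exists (z :: l), u, v, r.
Qed.

(** The path is cut at its first vertex in R, and then at the last vertex in L
    before that one. *)
Lemma crossing_subpath (T : eqType) (g : rel T) (L R : pred T) x p :
    path g x p -> uniq (x :: p) -> L x -> R (last x p) -> (forall z, L z -> ~~ R z) ->
  exists w W w', [/\ path g w (rcons W w'), uniq (w :: rcons W w'), L w, R w' &
    {subset w :: rcons W w' <= x :: p} /\ forall z, z \in W -> ~~ L z && ~~ R z].
Proof.
move=> pp up Lx Rl LR.
suff [//|[W [w' [pW uW sW Rw' inW]]]] :
    (exists w W w', [/\ path g w (rcons W w'), uniq (w :: rcons W w'), L w, R w' &
      {subset w :: rcons W w' <= x :: p} /\ forall z, z \in W -> ~~ L z && ~~ R z]) \/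
    (exists W w', [/\ path g x (rcons W w'), uniq (x :: rcons W w'),
      {subset rcons W w' <= p}, R w' & forall z, z \in W -> ~~ L z && ~~ R z]).
  exists x, W, w'; split=> //; split=> // z.
  by rewrite !inE => /predU1P[->|/sW ->]; rewrite ?eqxx ?orbT.
have nRx : ~~ R x by apply: LR.
move: (Lx) => _; elim: p x pp up Rl nRx {Lx} => [|z p IHp] x /=; first by move=> _ _ ->.
case/andP=> gxz pz /andP[xp up] Rl nRx.
have [Rz|nRz] := boolP (R z).
  right; exists [::], z; split=> //=; first by rewrite gxz.
    by move: xp; rewrite !inE negb_or => /andP[-> _].
  by move=> t; rewrite !inE => /eqP->; rewrite eqxx.
case: (IHp z pz up Rl nRz) => [[w [W [w' [pW uW Lw Rw' [sW inW]]]]]|[W [w' [pW uW sW Rw' inW]]]].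
  left; exists w, W, w'; split=> //; split=> // t /sW.
  by rewrite !inE => ->; rewrite orbT.
have [Lz|nLz] := boolP (L z).
  left; exists z, W, w'; split=> //; split=> // t; rewrite inE => /predU1P[->|/sW t_p].
    by rewrite !inE eqxx orbT.
  by rewrite !inE t_p !orbT.
right; exists (z :: W), w'; split=> //.
- by rewrite /= gxz.
- rewrite rcons_cons uW andbT; apply: contra xp; rewrite !inE => /predU1P[->|/sW->]; by rewrite ?eqxx ?orbT.
- by move=> t; rewrite !inE => /predU1P[->|/sW->]; rewrite ?eqxx ?orbT.
- by move=> t; rewrite inE => /predU1P[->|/inW //]; rewrite nLz nRz.
Qed.

Section TwoPaths.
Variables (T : finType) (g : rel T) (U A B : {set T}) (q0 : T).

(** Two disjoint paths that start at q0 and at a vertex of A and have advanced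
    along the given path q0 :: p1 ++ p2: one ends at the last vertex of
    q0 :: p1, the other one further on, in p2 or in B.  It is left open which
    of the two starts at q0, since rerouting exchanges the roles.  For empty p2
    both paths have arrived, at the end of the given path and in B. *)
Definition linkage (p1 p2 : seq T) : Prop :=
  exists hu pu hv pv, [/\ path g hu pu /\ path g hv pv,
    uniq ((hu :: pu) ++ (hv :: pv)),
    last hu pu = last q0 p1 /\ last hv pv \in B :|: [set z in p2],
    (hu = q0 /\ hv \in A) \/ (hv = q0 /\ hu \in A) &
    [/\ forall z, z \in pu ++ pv -> z \notin A,
        forall z, z \in hu :: pu -> z \notin B :|: [set z in p2] &
        forall z, z \in hv :: pv -> z \in B :|: [set z in p2] -> z = last hv pv]].

Hypothesis conn : forall z, connected_on g (U :\ z).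
Hypotheses (AU : A \subset U) (BU : B \subset U).

(** This is where 2-connectedness enters: the graph without z contains a path
    from A to B. *)
Lemma linkage_ear (z : T) (L R : {set T}) a r :
  a \in A -> a != z -> A \subset L -> r \in B -> r != z -> B \subset R -> [disjoint L & R] ->
  exists w W w', [/\ path g w (rcons W w'), uniq (w :: rcons W w'), w \in L, w' \in R &
    z \notin w :: rcons W w' /\ forall t, t \in W -> (t \notin L) && (t \notin R)].
Proof.
move=> aA az AL rB rz BR dLR.
have aU : a \in U :\ z by rewrite !inE az (subsetP AU).
have rU : r \in U :\ z by rewrite !inE rz (subsetP BU).
have [p pp [lp up sp]] := connect_restr_path (conn aU rU).
have := @crossing_subpath _ g [in L] [in R] _ _ pp up (subsetP AL _ aA).
rewrite lp => /(_ (subsetP BR _ rB)) [|w [W [w' [pW uW Lw Rw' [sW inW]]]]].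
  by move=> t tL; rewrite (disjointFr dLR tL).
exists w, W, w'; split=> //; split=> //; apply/negP=> /sW.
by rewrite inE eq_sym (negPf az) => /sp; rewrite !inE eqxx.
Qed.

(** One augmentation.  When the second path ends at w0 on the given path, an ear
    avoiding w0 leads from the part L that is already in use (the two paths, A
    and the piece p21 of the given path before w0) to the part R beyond w0.
    Whatever the vertex w where the ear leaves L, the path through w is cut
    there and continued along the ear, and the other path ends at w0, if
    necessary after following p21. *)
Lemma linkage_step p1 p21 w0 p22 :
  path g q0 (p1 ++ rcons p21 w0 ++ p22) -> uniq (q0 :: p1 ++ rcons p21 w0 ++ p22) ->
  (forall z, z \in q0 :: p1 ++ rcons p21 w0 ++ p22 -> z \notin A :|: B) ->
  A != set0 -> B != set0 -> [disjoint A & B] ->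
  (exists hu pu hv pv, [/\ path g hu pu /\ path g hv pv,
    uniq ((hu :: pu) ++ (hv :: pv)),
    last hu pu = last q0 p1 /\ last hv pv = w0,
    (hu = q0 /\ hv \in A) \/ (hv = q0 /\ hu \in A) &
    [/\ forall z, z \in pu ++ pv -> z \notin A,
        forall z, z \in hu :: pu -> z \notin B :|: [set z in rcons p21 w0 ++ p22] &
        forall z, z \in hv :: pv -> z \in B :|: [set z in rcons p21 w0 ++ p22] -> z = last hv pv]]) ->
  linkage (p1 ++ rcons p21 w0) p22.
Proof.
move=> pQ uQ QAB /set0Pn[a aA] /set0Pn[r rB] dAB.
case=> hu [pu [hv [pv [[pathu pathv] uuv [lu lv] heads [avA avu avv]]]]].
have w0Q : w0 \in q0 :: p1 ++ rcons p21 w0 ++ p22.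
  by rewrite inE !mem_cat mem_rcons inE eqxx !orbT.
have [w0A w0B] : w0 \notin A /\ w0 \notin B.
  by have := QAB _ w0Q; rewrite inE negb_or => /andP.

have [upp [w0p21 w0p2] [p12 dp]] : [/\ uniq p21 /\ uniq p22, w0 \notin p21 /\ w0 \notin p22 &
    (forall z, z \in p21 -> z \notin p22) /\ last q0 p1 \notin rcons p21 w0 ++ p22].
  move: uQ; rewrite -cat_cons cat_uniq => /and3P[_ /hasPn dp1].
  rewrite cat_uniq rcons_uniq => /and3P[/andP[w0p21 up21] /hasPn dp2 up22].
  split=> //.
  - by split=> //; apply/negP=> /dp2; rewrite /= mem_rcons mem_head.
  - split=> [z zp|]; first by apply/negP=> /dp2; rewrite /= mem_rcons inE zp orbT.
    by apply/negP=> /dp1; rewrite /= mem_last.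
pose L := A :|: [set z in hu :: pu] :|: [set z in hv :: pv] :|: [set z in p21].
pose R := B :|: [set z in p22].
have dLR : [disjoint L & R].
  rewrite disjoint_subset; apply/subsetP=> z; rewrite 3!in_setU => zL.
  rewrite inE /=; apply/negP=> zR.
  have zR' : z \in B :|: [set z in rcons p21 w0 ++ p22].
    by move: zR; rewrite !inE mem_cat => /orP[|] ->; rewrite ?orbT.
  case/orP: zL => [/orP[/orP[zA|]|]|].
  - move: zR; rewrite inE (disjointFr dAB zA) inE => /= zp22.
    by have := QAB z; rewrite inE !mem_cat zp22 !orbT inE zA => /(_ isT).
  - by rewrite inE => /avu; rewrite zR'.
  - rewrite inE => /avv/(_ zR'); rewrite lv => z_w0.
    by move: zR; rewrite z_w0 !inE (negPf w0B) (negPf w0p2).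
  - rewrite inE => zp; move: zR; rewrite !inE (negPf (p12 _ zp)) orbF => zB.
    by have := QAB z; rewrite inE !mem_cat mem_rcons inE zp !orbT inE zB orbT => /(_ isT).
have AL : A \subset L by rewrite /L -!setUA subsetUl.
have [||w [W [w' [pW uW wL w'R [w0W inW]]]]] :=
    @linkage_ear w0 L R a r aA _ AL rB _ (subsetUl _ _) dLR.
- by apply: contraNneq w0A => <-.
- by apply: contraNneq w0B => <-.
have seg : path g (last q0 p1) (rcons p21 w0).
  by move: pQ; rewrite !cat_path => /and3P[].
have LR z : z \in L -> z \notin R by move=> zL; rewrite (disjointFr dLR).
have Lu z : z \in hu :: pu -> z \in L by move=> zu; rewrite /L !inE -in_cons zu !orbT.
have Lv z : z \in hv :: pv -> z \in L.
  by move=> zv; rewrite /L in_setU; apply/orP; left; rewrite in_setU !inE -!in_cons zv orbT.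
have Lp z : z \in p21 -> z \in L by move=> zp; rewrite /L !inE zp !orbT.
have w0R : w0 \notin R by rewrite /R !inE negb_or w0B.
(* hu', pu' is the path that will end at w0, and hv', pv' the one that is cut at
   w and continued along the ear. *)
have finish hu' pu' hv' pv' :
    path g hu' pu' -> path g hv' pv' -> uniq ((hu' :: pu') ++ (hv' :: pv')) ->
    last hu' pu' = w0 -> last hv' pv' = w ->
    (hu' = q0 /\ hv' \in A) \/ (hv' = q0 /\ hu' \in A) ->
    (forall z, z \in pu' ++ pv' -> z \notin A) ->
    (forall z, z \in hu' :: pu' -> z \in L \/ z = w0) ->
    (forall z, z \in hv' :: pv' -> z \in L) ->
    linkage (p1 ++ rcons p21 w0) p22.
  move=> pathu' pathv' uuv' lu' lv' heads' avA' Lu' Lv'.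
  exists hu', pu', hv', (pv' ++ rcons W w'); split=> //.
  - by split=> //; rewrite cat_path pathv' lv'.
  - rewrite -cat_cons catA; apply: uniq_catI => // [|z].
      by case/andP: uW.
    rewrite mem_cat => zz; apply/negP=> zW.
    have [zL|z0] : z \in L \/ z = w0 by case/orP: zz => [/Lu' //|/Lv']; left.
      by move: zW; rewrite mem_rcons inE => /predU1P[zw|/inW]; [move: w'R; rewrite -zw (negPf (LR _ zL))|rewrite zL].
    by move: w0W; rewrite inE -z0 zW orbT.
  - by rewrite lu' !last_cat !last_rcons.
  split=> z.
  - rewrite catA mem_cat => /orP[/avA' //|]; rewrite mem_rcons inE => /predU1P[->|/inW/andP[zL _]].
      by apply: contraL w'R => /(subsetP AL)/LR.
    by apply: contra zL => /(subsetP AL).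
  - by move/Lu' => [/LR|->].
  rewrite -cat_cons mem_cat last_cat last_rcons => /orP[/Lv'/LR/negPf->//|].
  by rewrite mem_rcons inE => /predU1P[->|/inW/andP[_ /negPf->]].
have ww0 : w != w0 by apply: contraNneq w0W => <-; rewrite mem_head.
have uu : uniq (hu :: pu) by move: uuv; rewrite cat_uniq => /and3P[].
have uv : uniq (hv :: pv) by move: uuv; rewrite cat_uniq => /and3P[].
have duv z : z \in hu :: pu -> z \notin hv :: pv.
  move=> zu; apply/negP=> zv; move: uuv; rewrite cat_uniq => /and3P[_ /hasPn/(_ _ zv)].
  by rewrite /= zu.
have ndA z : z \in rcons p21 w0 -> z \notin A.
  move=> zp; have := QAB z; rewrite inE !mem_cat zp !orbT => /(_ isT).
  by rewrite inE negb_or => /andP[].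
have nup z : z \in hu :: pu -> z \notin rcons p21 w0.
  by move/avu; rewrite !inE mem_cat !negb_or => /and3P[].
have nvp z : z \in hv :: pv -> z \notin p21.
  move=> zv; apply/negP=> zp; have := avv _ zv; rewrite !inE mem_cat mem_rcons inE zp !orbT lv.
  by move/(_ isT) => z0; rewrite z0 (negPf w0p21) in zp.
have upp' : uniq (rcons p21 w0) by case: upp => up21 _; rewrite rcons_uniq w0p21.
have Lext z : z \in hu :: pu ++ rcons p21 w0 -> z \in L \/ z = w0.
  rewrite -cat_cons mem_cat mem_rcons inE => /orP[/Lu|/predU1P[|/Lp]]; by [left|right].
have pathext : path g hu (pu ++ rcons p21 w0) by rewrite cat_path pathu lu.
have lext : last hu (pu ++ rcons p21 w0) = w0 by rewrite last_cat last_rcons.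
have [wu|wNu] := boolP (w \in hu :: pu).
  case/splitPl: wu uu pathu avA duv Lu => u1 u2 lu1 uu pathu' avA duv Lu.
  move: uu pathu'; rewrite -cat_cons cat_uniq cat_path => /and3P[uu1 _ _] /andP[pathu1 _].
  apply: (finish hv pv hu u1) => //.
  - apply: uniq_catI => // z zv; apply/negP=> zu.
    by have := duv z; rewrite -cat_cons mem_cat zu zv => /(_ isT).
  - by case: heads; [right|left].
  - by move=> z; rewrite mem_cat orbC => zz; apply: avA; rewrite !mem_cat -orbA orbCA; case/orP: zz => ->; rewrite ?orbT.
  - by move=> z /Lv; left.
  - by move=> z zu; apply: Lu; rewrite -cat_cons mem_cat zu.
have [wv|wNv] := boolP (w \in hv :: pv).
  case/splitPl: wv lv uv pathv avA duv Lv nvp => v1 v2 lv1 lv uv pathv' avA duv Lv nvp.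
  move: uv pathv'; rewrite -cat_cons cat_uniq cat_path => /and3P[uv1 /hasPn dv _] /andP[pathv1 _].
  apply: (finish hu (pu ++ rcons p21 w0) hv v1) => //.
  - rewrite -cat_cons; apply: uniq_catI => // [|z].
      by apply: uniq_catI.
    rewrite mem_cat => /orP[/duv|zp]; first by rewrite -cat_cons mem_cat negb_or => /andP[].
    apply/negP=> zv1; move: zp; rewrite mem_rcons inE => /predU1P[z0|zp].
      move: lv; rewrite last_cat lv1 => lv2; case: v2 lv2 dv {avA duv Lv nvp} => [/eqP|x v2 /= lv2 dv].
        by rewrite (negPf ww0).
      by have := dv z; rewrite z0 -lv2 mem_last => /(_ isT); rewrite lv2 -z0 zv1.
    by have := nvp z; rewrite -cat_cons mem_cat zv1 zp => /(_ isT).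
  - move=> z; rewrite !mem_cat => /orP[/orP[zu|/ndA//]|zv]; apply: avA; by rewrite !mem_cat ?zu ?zv ?orbT.
  - by move=> z zv; apply: Lv; rewrite -cat_cons mem_cat zv.
have [wA|wNA] := boolP (w \in A).
  case: heads => [[hu0 hvA]|[hv0 huA]].
    apply: (finish hu (pu ++ rcons p21 w0) w [::]) => //.
    - rewrite -cat_cons; apply: uniq_catI => // [|z]; first exact: uniq_catI.
      rewrite mem_seq1 mem_cat => /orP[zu|zp]; first by apply: contraNneq wNu => <-.
      by apply: contraTneq zp => ->; apply: contraL wA => /ndA.
    - by left.
    - move=> z; rewrite cats0 mem_cat => /orP[zu|/ndA//]; apply: avA; by rewrite mem_cat zu.
    - by move=> z; rewrite inE => /eqP->; rewrite (subsetP AL).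
  apply: (finish hv pv w [::]) => //.
  - by apply: uniq_catI => // z zv; rewrite mem_seq1; apply: contraNneq wNv => <-.
  - by left.
  - move=> z; rewrite cats0 => zv; apply: avA; by rewrite mem_cat zv orbT.
  - by move=> z /Lv; left.
  - by move=> z; rewrite inE => /eqP->; rewrite (subsetP AL).
have wp : w \in p21.
  by move: wL; rewrite /L !inE (negPf wNA) -!in_cons (negPf wNu) (negPf wNv).
case/splitPr: wp upp' seg nup nvp ndA Lp {Lext pathext lext upp w0p21 p12 QAB finish} (finish) => a1 a2 upp' seg nup nvp ndA Lp finish.
have sub z : z \in rcons a1 w -> z \in a1 ++ w :: a2.
  by rewrite mem_rcons mem_cat !inE => /predU1P[->|->]; rewrite ?eqxx ?orbT.
have seg1 : path g (last q0 p1) (rcons a1 w).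
  by move: seg; rewrite -cat_rcons rcons_cat cat_path => /andP[].
apply: (finish hv pv hu (pu ++ rcons a1 w)) => //.
- by rewrite cat_path pathu lu.
- rewrite -cat_cons; apply: uniq_catI => // [|z zv].
    apply: uniq_catI => // [|z /nup].
      by move: upp'; rewrite rcons_cat rcons_cons -cat_rcons cat_uniq => /and3P[].
    by apply: contra => /sub zz; rewrite mem_rcons inE zz orbT.
  rewrite mem_cat negb_or; apply/andP; split; first by apply/negP=> /duv; rewrite zv.
  by apply: contra (nvp _ zv) => /sub.
- by rewrite last_cat last_rcons.
- by case: heads; [right|left].
- move=> z; rewrite !mem_cat orbCA => /orP[zu|/orP[zv|/sub zp]].
  + by apply: avA; rewrite mem_cat zu.
  + by apply: avA; rewrite mem_cat zv orbT.
  + by apply: ndA; rewrite mem_rcons inE zp orbT.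
- by move=> z /Lv; left.
- by move=> z; rewrite -cat_cons mem_cat => /orP[/Lu|/sub/Lp].
Qed.

(** Menger's theorem for two paths, in the augmenting form: both ends of the
    given path remain ends of the two disjoint paths. *)
Lemma two_disjoint_paths (qs : seq T) :
  path g q0 qs -> uniq (q0 :: qs) -> (forall z, z \in q0 :: qs -> z \notin A :|: B) ->
  A != set0 -> B != set0 -> [disjoint A & B] -> q0 \in U ->
  linkage qs [::].
Proof.
move=> pQ uQ QAB A0 B0 dAB q0U.
have q0AB : q0 \notin A /\ q0 \notin B.
  by have := QAB q0; rewrite mem_head inE negb_or => /(_ isT)/andP.
suff: forall p1 p2, qs = p1 ++ p2 -> linkage p1 p2 -> linkage qs [::].
  move=> IH; apply: (IH [::] qs erefl).
  case/set0Pn: (A0) => a aA; case/set0Pn: (B0) => r rB.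
  have [|||w [W [w' [pW uW wA w'R [q0W inW]]]]] :=
    @linkage_ear q0 A (B :|: [set z in qs]) a r aA _ (subxx A) rB _ (subsetUl _ _) _.
  - by apply: contraNneq q0AB.1 => <-.
  - by apply: contraNneq q0AB.2 => <-.
  - rewrite disjoint_subset; apply/subsetP=> z zA; rewrite !inE (disjointFr dAB zA) /=.
    by apply/negP=> zq; have := QAB z; rewrite inE zq orbT inE zA => /(_ isT).
  exists q0, [::], w, (rcons W w'); split=> //.
  - by apply/andP; split; [exact: q0W | exact: uW].
  - by rewrite last_rcons.
  - by left.
  split=> z.
  - rewrite mem_rcons inE => /predU1P[->|/inW/andP[] //].
    apply: contraL w'R => w'A; rewrite !inE (disjointFr dAB w'A) /=.
    by apply/negP=> zq; have := QAB w'; rewrite inE zq orbT inE w'A => /(_ isT).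
  - rewrite inE => /eqP->; rewrite !inE (negPf q0AB.2) /=.
    by case/andP: uQ.
  rewrite last_rcons inE => /predU1P[->|].
    rewrite inE (disjointFr dAB wA) inE => /= zq.
    by have := QAB w; rewrite inE zq orbT inE wA => /(_ isT).
  by rewrite mem_rcons inE => /predU1P[//|/inW/andP[_ /negPf->]].
move=> p1 p2; have [n] := ubnP (size p2); elim: n p1 p2 => // n IHn p1 p2 ltn def_qs Lk.
case: (Lk) => hu [pu [hv [pv [[pathu pathv] uuv [lu lv] heads [avA avu avv]]]]].
have [vB|vNB] := boolP (last hv pv \in B); last first.
  have vp2 : last hv pv \in p2 by move: lv; rewrite !inE (negPf vNB).
  move: pQ uQ QAB; rewrite def_qs; case/splitPr: vp2 ltn def_qs Lk lv avu avv => p21 p22.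
  rewrite -cat_rcons => ltn def_qs Lk lv avu avv pQ uQ QAB.
  rewrite -def_qs; apply: (IHn (p1 ++ rcons p21 (last hv pv)) p22).
  - move: ltn; rewrite size_cat size_rcons ltnS addSn; apply: leq_trans.
    by rewrite ltnS leq_addl.
  - by rewrite -catA.
  apply: linkage_step => //.
  by exists hu, pu, hv, pv.
have sub z : z \in p2 -> z \in q0 :: qs by move=> zp; rewrite def_qs inE mem_cat zp !orbT.
have dp2 z : z \in p2 -> (z \notin hu :: pu) && (z \notin hv :: pv).
  move=> zp; apply/andP; split; apply/negP.
    by move/avu; rewrite !inE zp orbT.
  move=> zv; have := avv _ zv; rewrite !inE zp orbT => /(_ isT) z0.
  by have := QAB _ (sub _ zp); rewrite z0 inE vB orbT.
exists hu, (pu ++ p2), hv, pv; split=> //.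
- split=> //; rewrite cat_path pathu lu /=.
  by move: pQ; rewrite def_qs cat_path => /andP[].
- move: uuv; rewrite cat_uniq => /and3P[uu duv uv].
  rewrite -cat_cons; apply: uniq_catI => //.
    apply: uniq_catI => // [|z zu].
      by move: uQ; rewrite def_qs -cat_cons cat_uniq => /and3P[].
    by apply: contraL zu => /dp2/andP[].
  move=> z; rewrite mem_cat => /orP[zu|/dp2/andP[] //].
  by apply/negP=> zv; move/hasPn/(_ _ zv): duv; rewrite /= zu.
- by rewrite last_cat lu def_qs last_cat inE vB.
split=> z.
- rewrite -catA !mem_cat orbCA => /orP[zp|zz]; last by apply: avA; rewrite mem_cat.
  by have := QAB _ (sub _ zp); rewrite inE negb_or => /andP[].
- rewrite -cat_cons mem_cat => /orP[/avu|/sub/QAB]; rewrite !inE !negb_or ?andbT => /andP[] //.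
- by rewrite !inE orbF => zv zB; apply: avv; rewrite ?inE ?zB.
Qed.
End TwoPaths.

(** * The lemma of Posa *)

Section ListPairs.
Variables (T : eqType) (a b : pred T).

(** Each consecutive pair of the list contributes at most one to the left-hand
    side.  With a and b adjacency to the two ends of a path, this bounds the sum
    of their degrees on a stretch where no two consecutive vertices cross. *)
Lemma cross_count z q :
    path (fun l r => ~~ (a l && b r)) z q ->
  count a (belast z q) + count b q <= size q.
Proof.
elim: q z => [|t q IHq] z //= /andP[nab /IHq].
move: nab; case: (a z); case: (b t) => //= _; lia.
Qed.

(** A pair at minimal distance: no vertex between its members satisfies a or b,
    since it would give a closer pair. *)
Lemma closest_pair s l u M v r :
    s = l ++ u :: M ++ v :: r -> a u -> b v ->
  exists l' u' M' v' r', [/\ s = l' ++ u' :: M' ++ v' :: r', a u' /\ b v',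
    forall t, t \in M' -> ~~ a t, forall t, t \in M' -> ~~ b t &
    M' = [::] \/ sorted (fun l r => ~~ (a l && b r)) s].
Proof.
have [n] := ubnP (size M); elim: n l u M v r => // n IHn l u M v r leM Es au bv.
have [/hasP[t tM at_]|/hasPn naM] := boolP (has a M).
  case/splitPr: tM leM Es => M1 M2; rewrite size_cat /= => leM Es.
  by apply: (IHn (l ++ u :: M1) t M2 v r) => //; [lia | rewrite Es -!catA].
have [/hasP[t tM bt]|/hasPn nbM] := boolP (has b M).
  case/splitPr: tM leM Es => M1 M2; rewrite size_cat /= => leM Es.
  by apply: (IHn l u M1 t (M2 ++ v :: r)) => //; [lia | rewrite Es -!catA].
have [so|/not_sorted_step[l' [u' [v' [r' [Es' /negPn/andP[au' bv']]]]]]] :=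
  boolP (sorted (fun l r => ~~ (a l && b r)) s).
  by exists l, u, M, v, r; split=> //; right.
by exists l', u', [::], v', r'; split=> //; left.
Qed.
End ListPairs.

Section Walks.
Variables (T : finType) (g : rel T).
Hypothesis gsym : symmetric g.

Lemma rev_walk a p :
  path g a p -> exists q, [/\ rev (a :: p) = last a p :: q, path g (last a p) q & last (last a p) q = a].
Proof.
move=> pp; exists (rev (belast a p)); split.
- by rewrite lastI rev_rcons.
- by rewrite rev_path (eq_path (e' := g)).
case: p {pp} => //= b p; rewrite rev_cons; exact: last_rcons.
Qed.

Lemma rev_walk_rcons a m b : path g a (rcons m b) -> path g b (rcons (rev m) a).
Proof.
case/rev_walk=> q []; rewrite last_rcons rev_cons rev_rcons /= => -[<-] //.
Qed.

(** The path goes back from alpha to x, jumps to the first neighbour h of x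
    after alpha and follows A to xa.  It omits only vertices between alpha and
    h, none of which is a neighbour of x. *)
Lemma mid_path x A xa alpha :
    path g x (rcons A xa) -> uniq (x :: rcons A xa) -> g x xa -> alpha \in x :: A ->
  exists mid, [/\ path g alpha (rcons mid xa), uniq (alpha :: mid), {subset alpha :: mid <= x :: A} &
    forall z, z \in x :: A -> (z == x) || g x z -> z \in alpha :: mid].
Proof.
move=> pA uA gxa aA.
have [A1 [A2 EA]] : exists A1 A2, x :: A = A1 ++ alpha :: A2.
  by case/splitPr: aA => A1 A2; exists A1, A2.
have : has (g x) (rcons A2 xa) by rewrite has_rcons gxa.
case/split_first=> C1 [h [C2 [EC gxh nC1]]].
have [C3 EC3] : exists C3, rcons C3 xa = h :: C2.
  exists (belast h C2); rewrite lastI; congr rcons.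
  by have /(congr1 (last xa)) := EC; rewrite last_rcons last_cat /=.
have EA2 : A2 = C1 ++ C3.
  by have : rcons A2 xa = rcons (C1 ++ C3) xa; [rewrite EC -EC3 rcons_cat | case/rcons_inj].
have uA' : uniq (rcons (A1 ++ alpha :: C1 ++ C3) xa) by rewrite -EA2 -EA.
have [pC pA1] : path g h C2 /\ path g alpha (rcons (rev A1) h).
  have pE : sorted g (A1 ++ alpha :: C1 ++ h :: C2).
    by rewrite -EC -rcons_cons -rcons_cat -EA.
  split; first by move: pE; rewrite -cat_cons catA; case/cat_sorted2=> _.
  case: A1 EA pE {uA'} => [|x' A1] [<- EA]; first by rewrite /= gxh.
  rewrite /= cat_path /= => /and3P[pA1 gl _].
  have : path g x (rcons A1 alpha) by rewrite rcons_path pA1.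
  by move/rev_walk_rcons=> pr; rewrite rev_cons rcons_path pr last_rcons.
exists (rev A1 ++ C3); split.
- by rewrite rcons_cat EC3 -cat_rcons cat_path pA1 last_rcons.
- have : subseq (A1 ++ alpha :: C3) (rcons (A1 ++ alpha :: C1 ++ C3) xa).
    rewrite -cats1 -[X in subseq X]cats0 cat_subseq ?sub0seq //.
    by rewrite cat_subseq //= eqxx suffix_subseq.
  move/subseq_uniq/(_ uA'); rewrite -cat_rcons cat_uniq rcons_uniq.
  case/and3P=> /andP[aA1 u1] d13 u3.
  rewrite /= mem_cat mem_rev (negPf aA1) /= cat_uniq rev_uniq u1 u3 andbT.
  apply/andP; split; first by apply/negP=> aC; case/hasPn/(_ _ aC): d13; rewrite /= mem_rcons mem_head.
  by apply/hasPn=> z zC; apply: contra (hasPn d13 _ zC) => /=; rewrite mem_rcons mem_rev inE => ->; rewrite orbT.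
- move=> z; rewrite EA EA2 !inE !mem_cat mem_rev !inE mem_cat.
  by case/or3P=> ->; rewrite ?orbT.
- move=> z; rewrite EA EA2 !inE !mem_cat mem_rev !inE mem_cat.
  case/or4P=> [->|->|zC1|->]; rewrite ?orbT // (negPf (nC1 _ zC1)) orbF => /eqP zx.
  move: uA'; rewrite -cat_rcons rcons_cat cat_uniq => /and3P[_ /hasPn dA _].
  have : x \in rcons A1 alpha.
    by case: A1 EA {pA1 dA} => [|x' A1] [<- _]; rewrite /= mem_head.
  by have := dA z; rewrite rcons_cat mem_cat zC1 /= zx => /(_ isT)/negPf->.
Qed.


(** With u and v as close as possible, the cycle x .. u, y .. v, x omits only the
    vertices between u and v.  Either there is none, or these vertices are not
    adjacent to the ends x and y and no consecutive vertices cross, so that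
    [cross_count] bounds the degrees by the number of vertices kept. *)
Lemma crossing_cycle x p l u M v r :
    path g x p -> uniq (x :: p) -> ~~ g x x -> ~~ g (last x p) (last x p) -> ~~ g (last x p) x ->
    x :: p = l ++ u :: M ++ v :: r -> g (last x p) u -> g x v ->
  exists c, [/\ cycle g c, uniq c &
    size (x :: p) <= size c \/ count (g x) (x :: p) + count (g (last x p)) (x :: p) <= size c].
Proof.
set y := last x p => pp up nxx nyy nyx Ep0 gyu gxv.
have [{l u M v r Ep0 gyu gxv} l [w [M [v [r [Ep [gyw gxv] naM nbM near]]]]]] := closest_pair Ep0 gyu gxv.
have ww : w != x by apply: contraNneq nyx => <-.
case: l Ep => [[xw _] |x' l [_ Ep]]; first by rewrite xw eqxx in ww.
have ly : y = last v r by rewrite /y Ep last_cat /= last_cat.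
have pw : path g x (rcons l w).
  by move: pp; rewrite Ep -cat_rcons cat_path => /andP[].
have pv : path g v r.
  by move: pp; rewrite Ep cat_path /= cat_path /= => /and5P[].
have [q [Eq pq lq]] := rev_walk pv.
exists (x :: rcons l w ++ rev (v :: r)); split.
- rewrite /= Eq rcons_cat cat_path pw last_rcons /= -ly gsym gyw /=.
  by rewrite rcons_path ly pq lq gsym.
- have : subseq ((x :: rcons l w) ++ v :: r) (x :: p).
    by rewrite Ep -(cat_rcons w) /= eqxx cat_subseq // suffix_subseq.
  move/subseq_uniq/(_ up); rewrite -cat_cons !cat_uniq rev_uniq => /and3P[-> d12 ->].
  rewrite andbT; apply: contra d12 => /hasP[z]; rewrite mem_rev => z1 z2.
  by apply/hasP; exists z.
have -> : size (x :: rcons l w ++ rev (v :: r)) = size l + size r + 3.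
  by rewrite /= size_cat size_rcons size_rev /= !addnS addn0.
case: near => [M0|near].
  by left; rewrite Ep M0 /= size_cat /= !addnS addn0.
right.
have cM (a : pred T) : (forall t, t \in M -> ~~ a t) -> count a M = 0.
  by move=> h; apply/eqP; rewrite -leqn0 leqNgt -has_count; apply/hasPn.
have -> : count (g y) (x :: p) = count (g y) (belast x (rcons l w)) + 1 + count (g y) (belast v r).
  rewrite Ep -cat_cons count_cat belast_rcons /= gyw count_cat lastI -cats1 count_cat /= -ly.
  by rewrite (negPf nyy) cM // !addn0 addnA.
have -> : count (g x) (x :: p) = count (g x) (rcons l w) + 1 + count (g x) r.
  rewrite Ep /= (negPf nxx) add0n -(cat_rcons w) !count_cat /= gxv.
  by rewrite (cM _ nbM) add0n -addnA.
have := near; rewrite /= Ep -(cat_rcons w) !cat_path /= => /and4P[near1 _ _ near2].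
have := cross_count near1; have := cross_count near2; rewrite size_rcons.
move: (count _ _) (count _ _) (count _ _) (count _ _) => c1 c2 c3 c4 h1 h2.
move: (size l) (size r) h1 h2 => sl sr h1 h2; clear -h1 h2; lia.
Qed.
End Walks.

Section Posa.
Variables (T : finType) (g : rel T) (U : {set T}).
Hypotheses (gsym : symmetric g) (girr : irreflexive g).
Hypothesis gU : forall x y, g x y -> x \in U.
Hypothesis conn : forall z, connected_on g (U :\ z).

(** The two disjoint paths from A and xa to the last vertex of qs and Bl are
    joined by two paths given by [mid_path], one inside A through x and one
    inside Bl through the last vertex y; these contain all neighbours of x in
    A and of y in Bl. *)
Lemma no_crossing_cycle x A xa qs Bl :
    path g x (A ++ xa :: qs ++ Bl) -> uniq (x :: A ++ xa :: qs ++ Bl) -> Bl != [::] ->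
    g x xa -> g (last xa Bl) (last xa qs) ->
  exists c, [/\ cycle g c, uniq c &
    (forall z, z \in x :: A -> (z == x) || g x z -> z \in c) /\
    (forall z, z \in Bl -> (z == last xa Bl) || g (last xa Bl) z -> z \in c) /\
    xa \in c /\ last xa qs \in c].
Proof.
set y := last xa Bl; set xb := last xa qs => pP uP B0 gxa gyb.
have pU z : z \in x :: A ++ xa :: qs ++ Bl -> z \in U.
  have : forall s u, path g u s -> u \in U -> z \in u :: s -> z \in U.
    elim=> [|t s IHs] u /=; first by rewrite mem_seq1 => _ ? /eqP->.
    case/andP=> gut /IHs{}IHs uU; rewrite inE => /predU1P[->//|]; apply: IHs.
    by apply: (gU (y := u)); rewrite gsym.
  by move/(_ _ _ pP); apply; apply: gU gxa.
have [pA pq pB] : [/\ path g x (rcons A xa), path g xa qs & path g xb Bl].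
  by move: pP; rewrite -cat_rcons cat_path last_rcons cat_path => /and3P[].
have yB : y \in Bl by rewrite /y; case: (Bl) B0 => //= *; apply: mem_last.
have [uA uq uB] : [/\ uniq (x :: rcons A xa), uniq (xa :: qs) & uniq (xb :: Bl)].
  split; apply: (subseq_uniq _ uP).
  - by rewrite -cat_rcons /= eqxx prefix_subseq.
  - by rewrite -(cat_cons x) -[xa :: qs ++ Bl]cat_cons catA; apply: subseq_trans (prefix_subseq _ _) ; apply: suffix_subseq.
  - rewrite -(cat_cons x) -[xa :: qs ++ Bl]cat_cons catA -cat1s cat_subseq // sub1seq.
    by rewrite mem_cat mem_last orbT.
pose SA := [set z in x :: A]; pose SB := [set z in Bl].
have [dAB dAq dBq] : [/\ forall z, z \in x :: A -> z \notin Bl,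
    forall z, z \in x :: A -> z \notin xa :: qs & forall z, z \in Bl -> z \notin xa :: qs].
  move: uP; rewrite -(cat_cons x) -[xa :: qs ++ Bl]cat_cons cat_uniq => /and3P[_ /hasPn d1].
  rewrite cat_uniq => /and3P[_ /hasPn d2 _]; split=> z zA; apply/negP=> zB.
  - by have /negP := d1 z ltac:(by rewrite mem_cat zB orbT); apply.
  - by have /negP := d1 z ltac:(by rewrite mem_cat zB); apply.
  - by have /negP := d2 z zA; apply.
have [|||||||hu [pu [hv [pv [[pathu pathv] uuv [lu lv] heads [avA avu avv]]]]]] :=
  @two_disjoint_paths _ g U SA SB xa conn _ _ qs pq uq.
- by apply/subsetP=> z; rewrite inE => zA; apply: pU; rewrite -(cat_cons x) mem_cat zA.
- by apply/subsetP=> z; rewrite inE => zB; apply: pU; rewrite inE !mem_cat inE mem_cat zB !orbT.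
- move=> z zq; rewrite !inE -in_cons negb_or; apply/andP; split.
    by apply/negP=> /dAq; rewrite zq.
  by apply/negP=> /dBq; rewrite zq.
- by apply/set0Pn; exists x; rewrite inE mem_head.
- by apply/set0Pn; exists y; rewrite inE.
- by rewrite disjoint_subset; apply/subsetP=> z; rewrite !inE -in_cons => /dAB.
- by apply: pU; rewrite inE mem_cat mem_head !orbT.
have setB z : (z \in SB :|: [set z0 in [::]]) = (z \in Bl) by rewrite !inE orbF.
move: lv; rewrite setB => vB.
have {}avu z : z \in hu :: pu -> z \notin Bl by move/avu; rewrite setB.
have {}avv z : z \in hv :: pv -> z \in Bl -> z = last hv pv by move=> ? ?; apply: avv; rewrite ?setB.
have {}avA z : z \in pu ++ pv -> z \notin x :: A by move/avA; rewrite inE.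
have nxaA : xa \notin x :: A by apply/negP=> /dAq; rewrite mem_head.
have [m2 [pm2 um2 sm2 cov2]] : exists m2, [/\ path g hv (rcons m2 hu), uniq m2,
    forall z, z \in m2 -> [&& z \in x :: A, z != hu & z != hv] &
    forall z, z \in x :: A -> (z == x) || g x z -> z \in [:: hu, hv & m2]].
  have mid al : al \in x :: A -> exists mid, [/\ path g al (rcons mid xa), uniq mid,
      forall z, z \in mid -> [&& z \in x :: A, z != xa & z != al] &
      forall z, z \in x :: A -> (z == x) || g x z -> z \in al :: mid].
    move=> alA; have [mid [pmid umid smid cmid]] := mid_path gsym pA uA gxa alA.
    exists mid; split=> //; first by case/andP: umid.
    move=> z zm; have zA : z \in x :: A by apply: smid; rewrite inE zm orbT.
    rewrite zA /=; apply/andP; split; first by apply: contraNneq nxaA => <-.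
    by apply: contraTneq umid => <-; rewrite /= zm.
  case: heads => [[-> vA]|[-> uA']].
    have [m [pm um sm cm]] := mid hv ltac:(by move: vA; rewrite inE).
    exists m; split=> // z zA /(cm _ zA) zm; by rewrite inE zm orbT.
  have [m [pm um sm cm]] := mid hu ltac:(by move: uA'; rewrite inE).
  exists (rev m); split=> //.
  - exact: rev_walk_rcons.
  - by rewrite rev_uniq.
  - by move=> z; rewrite mem_rev => /sm/and3P[-> -> ->].
  move=> z zA /(cm _ zA); rewrite !inE mem_rev => /orP[->//|->]; by rewrite !orbT.
have [m1 [pm1 um1 sm1 cov1]] : exists m1, [/\ path g xb (rcons m1 (last hv pv)), uniq m1,
    forall z, z \in m1 -> (z \in Bl) && (z != last hv pv) &
    forall z, z \in Bl -> (z == y) || g y z -> z \in last hv pv :: m1].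
  have [q [Eq pq' lq]] := rev_walk gsym pB.
  have [B' EB] : exists B', rev Bl = y :: B'.
    by rewrite /y; case: (Bl) B0 => // z s _; exists (rev (belast z s)); rewrite [in LHS]lastI rev_rcons.
  have Eq' : q = rcons B' xb by move: Eq; rewrite rev_cons EB rcons_cons => -[].
  have lB : last xb Bl = y by rewrite /y; case: (Bl) B0.
  have memB z : (z \in y :: B') = (z \in Bl) by rewrite -EB mem_rev.
  have [|||mid [pmid umid smid cmid]] := mid_path gsym (x := y) (A := B') (xa := xb) (alpha := last hv pv) _ _ gyb.
  - by rewrite -Eq' -lB.
  - by rewrite -rcons_cons -EB -rev_cons rev_uniq.
  - by rewrite memB.
  exists (rev mid); split.
  - exact: rev_walk_rcons.
  - by rewrite rev_uniq; case/andP: umid.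
  - move=> z; rewrite mem_rev => zm; rewrite -memB smid ?inE ?zm ?orbT //.
    by apply: contraTneq umid => <-; rewrite /= zm.
  by move=> z; rewrite -memB => zB /(cmid _ zB); rewrite !inE mem_rev.
have [q [Eq pq' lq]] := rev_walk gsym pathv.
have mem_q z : (z \in last hv pv :: q) = (z \in hv :: pv) by rewrite -Eq mem_rev.
exists (hu :: pu ++ m1 ++ (last hv pv :: q) ++ m2); split.
- rewrite -[cycle _ _]/(path g hu (rcons (pu ++ m1 ++ (last hv pv :: q) ++ m2) hu)).
  rewrite !rcons_cat cat_path pathu lu -/xb cat_cons -cat_rcons cat_path pm1 last_rcons.
  by rewrite cat_path pq' lq pm2.
- have [uu uv duv] : [/\ uniq (hu :: pu), uniq (hv :: pv) & forall z, z \in hu :: pu -> z \notin hv :: pv].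
    move: uuv; rewrite cat_uniq => /and3P[-> d ->]; split=> // z zu.
    by apply: contra d => zv; apply/hasP; exists z.
  have dA z : z \in [:: hu] ++ [:: hv] ++ pu ++ pv -> z \notin m2.
    rewrite !inE; case/or3P=> [/eqP->|/eqP->|zz].
    + by apply/negP=> /sm2; rewrite eqxx andbF.
    + by apply/negP=> /sm2; rewrite eqxx !andbF.
    by apply/negP=> /sm2/andP[]; rewrite (negPf (avA _ zz)).
  rewrite -cat_cons; apply: uniq_catI => //.
    apply: uniq_catI => // [|z /sm1/andP[zB zl]].
      apply: uniq_catI => // [|z].
        by rewrite -Eq rev_uniq.
      rewrite mem_q inE => zv; apply: dA; rewrite !inE mem_cat.
      by case/orP: zv => ->; rewrite !orbT.
    rewrite mem_cat mem_q negb_or; apply/andP; split.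
      by apply: contraNN zl => /avv/(_ zB)->.
    by apply/negP=> /sm2/and3P[/dAB]; rewrite zB.
  move=> z zu; rewrite mem_cat negb_or [z \in (_ :: _) ++ _]mem_cat negb_or mem_q duv //=; apply/andP; split.
    by apply: contraNN (avu _ zu) => /sm1/andP[].
  apply: dA; move: zu; rewrite !inE mem_cat => /orP[->//|->]; by rewrite !orbT.
have mem_c z : z \in hu :: pu ++ m1 ++ (last hv pv :: q) ++ m2 =
    [|| z \in hu :: pu, z \in m1, z \in hv :: pv | z \in m2].
  by rewrite -cat_cons !mem_cat mem_q.
split=> [z zA /(cov2 _ zA)|].
  rewrite mem_c inE => /predU1P[->|]; first by rewrite mem_head.
  by rewrite inE => /predU1P[->|->]; rewrite ?mem_head ?orbT.
split=> [z zB /(cov1 _ zB)|].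
  rewrite mem_c inE => /predU1P[->|->]; last by rewrite orbT.
  by rewrite mem_last !orbT.
split; rewrite mem_c.
  by case: heads => -[<- _]; rewrite mem_head ?orbT.
by rewrite /xb -lu mem_last.
Qed.

(** Either some neighbour of the last vertex y precedes a neighbour of x on the
    path, and [crossing_cycle] applies; or the neighbours of x all come before
    those of y, with at most one common vertex xa, and the cycle of
    [no_crossing_cycle] contains x, y and all these neighbours, which makes at
    least d(x) + d(y) + 1 vertices. *)
Lemma posa_cycle x p k :
    path g x p -> uniq (x :: p) -> x != last x p -> ~~ g x (last x p) ->
    k <= size (x :: p) -> k <= count (g x) (x :: p) + count (g (last x p)) (x :: p) ->
  exists c, [/\ cycle g c, uniq c & k <= size c].
Proof.
set y := last x p => pp up xy nxy kp kd.
have crossing u v l M r : x :: p = l ++ u :: M ++ v :: r -> g y u -> g x v ->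
    exists c, [/\ cycle g c, uniq c & k <= size c].
  move=> Ep gyu gxv.
  have [|||c [cc uc sc]] := crossing_cycle gsym pp up _ _ _ Ep gyu gxv.
  - by rewrite girr.
  - by rewrite girr.
  - by rewrite gsym.
  by exists c; split=> //; case: sc => /(leq_trans _)->.
have [z1 [p1 Ep1]] : exists z1 p1, p = z1 :: p1.
  by move: xy; rewrite /y; case: (p) => [|z1 p1]; [rewrite /= eqxx | exists z1, p1].
have /split_last[A0 [xa [R [EA gxa nR]]]] : has (g x) (x :: p).
  by apply/hasP; exists z1; [rewrite Ep1 !inE eqxx orbT | move: pp; rewrite Ep1 => /andP[]].
have [A EA0] : exists A, A0 = x :: A.
  case: A0 EA => [|x' A] [xE _]; last by exists A; rewrite xE.
  by rewrite -xE girr in gxa.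
have [/hasP[u uA gyu]|nA] := boolP (has (g y) A0).
  case/splitPr: uA EA {EA0} => l M EA.
  by apply: (crossing u xa l M R) => //; rewrite EA -catA.
have yR : has (g y) (xa :: R).
  have : has (g y) (x :: p).
    apply/hasP; exists (last x (belast z1 p1)); last first.
      have : path g x (rcons (belast z1 p1) (last z1 p1)) by rewrite -lastI -Ep1.
      by rewrite rcons_path => /andP[_]; rewrite gsym /y Ep1.
    have := mem_last x (belast z1 p1); rewrite !inE => /predU1P[->|]; first by rewrite eqxx.
    by move/mem_belast; rewrite Ep1 => ->; rewrite orbT.
  by rewrite EA has_cat (negPf nA).
have [S1 [xb [Bl [EB gyb nS1]]]] := split_first yR.
have [qs Eqs] : exists qs, rcons S1 xb = xa :: qs.
  by case: S1 EB {nS1} => [|z S1] [<- _]; [exists [::] | exists (rcons S1 xb)].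
have ER : xa :: R = (xa :: qs) ++ Bl by rewrite -Eqs cat_rcons.
have lqs : last xa qs = xb by have /(congr1 (last xa)) := Eqs; rewrite last_rcons.
have lR : last xa R = y by rewrite /y; have /(congr1 (last x)) := EA; rewrite last_cat.
have lB : Bl != [::] /\ last xa Bl = y.
  have : last xa (qs ++ Bl) = y by rewrite -lR; case: ER => ->.
  rewrite last_cat lqs; case: (Bl) => [/= yxb|//]; by rewrite yxb girr in gyb.
have Ep : p = A ++ xa :: qs ++ Bl by move: EA; rewrite EA0 ER => -[].
have [] := @no_crossing_cycle x A xa qs Bl _ _ lB.1 gxa _.
- by rewrite -Ep.
- by rewrite -Ep.
- by rewrite lB.2 lqs.
rewrite lB.2 lqs => c [cc uc [covA [covB [xac xbc]]]].
exists c; split=> //; apply: leq_trans kd _.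
rewrite -!card_set_filter //; set Nx := finset _; set Ny := finset _.
have sAx z : z \in x |: Nx -> z \in rcons (x :: A) xa /\ z \in c.
  move=> zN; have zN' : (z == x) || g x z by move: zN; rewrite !inE => /orP[->//|/andP[_ ->]]; rewrite orbT.
  have : z \in x :: p by move: zN; rewrite !inE => /orP[->//|/andP[]].
  rewrite EA EA0 -cat_rcons mem_cat => /orP[zA|zR].
    split=> //; move: zA; rewrite mem_rcons inE => /predU1P[->//|zA]; exact: covA.
  have zx : z != x.
    apply: contraTneq zR => ->; move: up; rewrite EA EA0 /= => /andP[+ _].
    by apply: contra; rewrite mem_cat inE => ->; rewrite !orbT.
  by move: zN'; rewrite (negPf zx) (negPf (nR _ zR)).
have sBy z : z \in y |: Ny -> z \in xb :: Bl /\ z \in c.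
  move=> zN; have zN' : (z == y) || g y z by move: zN; rewrite !inE => /orP[->//|/andP[_ ->]]; rewrite orbT.
  have : z \in x :: p by move: zN; rewrite !inE => /orP[/eqP->|/andP[] //]; rewrite -in_cons mem_last.
  have yB : y \in Bl by rewrite -lB.2; case: (Bl) lB.1 => //= *; apply: mem_last.
  have nyS t : t \in A0 ++ S1 -> (t == y) || g y t = false.
    move=> tS; apply/negbTE; rewrite negb_or; apply/andP; split; last first.
      by move: tS; rewrite mem_cat => /orP[/(hasPn nA)|/nS1].
    apply: contraTneq tS => ->; move: up; rewrite EA EB catA cat_uniq => /and3P[_ /hasPn d _].
    by apply: (d y); rewrite inE yB orbT.
  rewrite EA EB catA mem_cat => /orP[/nyS|zB]; first by rewrite zN'.
  split=> //; move: zB; rewrite inE => /predU1P[->|zB]; [exact: xbc | exact: covB].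
have cx : #|x |: Nx| = #|Nx|.+1 by rewrite cardsU1 inE girr andbF.
have cy : #|y |: Ny| = #|Ny|.+1 by rewrite cardsU1 inE girr andbF.
have cU : #|(x |: Nx) :|: (y |: Ny)| <= size c.
  rewrite -(card_uniqP uc); apply: subset_leq_card; apply/subsetP=> z.
  by rewrite in_setU => /orP[/sAx|/sBy] [].
have cI : #|(x |: Nx) :&: (y |: Ny)| <= 1.
  rewrite -(cards1 xa); apply: subset_leq_card; apply/subsetP=> z.
  rewrite in_setI in_set1 => /andP[/sAx[zA _] /sBy[zB _]].
  move: zA; rewrite mem_rcons inE => /predU1P[->//|zA].
  move: up; rewrite EA EB catA cat_uniq => /and3P[_ /hasPn d _].
  by have /negP[] := d z zB; rewrite /= mem_cat EA0 zA.
have := cardsUI (x |: Nx) (y |: Ny); rewrite cx cy.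
move: #|_ :|: _| #|_ :&: _| cU cI => a b; clear; lia.
Qed.
End Posa.

(** * Cliques in graphs without long cycles *)

Section Degrees.
Variables (T : finType) (g : rel T).

Definition mindeg (S : {set T}) (d : nat) : bool :=
  [forall x in S, d <= #|[set z in S | g x z]|].

Lemma mindegP (S : {set T}) d :
  reflect (forall x, x \in S -> d <= #|[set z in S | g x z]|) (mindeg S d).
Proof. exact: forall_inP. Qed.

(** The members of F through v, with v deleted, form an antichain of sets of size
    at most r - 1 inside the set N of at most a points. *)
Lemma card_remove_vertex (F : {set {set T}}) (r a : nat) (S N : {set T}) v :
    antichain F -> (forall A, A \in F -> #|A| <= r) -> #|N| <= a ->
    (forall A, A \in F -> A \subset S -> v \in A -> A :\ v \subset N) ->
  #|[set A in F | A \subset S]| <= #|[set A in F | A \subset S :\ v]| + antichain_bound r.-1 a.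
Proof.
move=> acF leF leN inN.
have -> : [set A in F | A \subset S] =
    [set A in F | A \subset S :\ v] :|: [set A in F | (A \subset S) && (v \in A)].
  apply/setP=> A; rewrite !inE subsetD1 -andb_orr.
  by case: (A \in F) (A \subset S) (v \in A) => [] [] [].
apply: leq_trans (leq_card_setU _ _) _; rewrite leq_add2l.
set G := [set A in F | _].
have injG : {in G &, injective (fun A : {set T} => A :\ v)}.
  move=> A B; rewrite !inE => /and3P[_ _ vA] /and3P[_ _ vB] eAB.
  by rewrite -(setD1K vA) eAB setD1K.
rewrite -(card_in_imset injG); apply: leq_trans (leq_antichain_bound _ leN).
apply: sperner.
- move=> _ _ /imsetP[A + ->] /imsetP[B + ->]; rewrite !inE => /and3P[AF _ vA] /and3P[BF _ vB] sAB.
  by rewrite (acF A B) // -(setD1K vA) -(setD1K vB) setUS.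
- by move=> _ /imsetP[A + ->]; rewrite inE => /and3P[AF AS vA]; apply: inN.
move=> _ /imsetP[A + ->]; rewrite inE => /and3P[AF _ vA].
by have := leF _ AF; rewrite (cardsD1 v A) vA; case: (r).
Qed.

(** While more than s vertices are left, one of them has degree at most a;
    deleting it costs at most antichain_bound (r - 1) a members of F, and the
    last s vertices carry at most antichain_bound r s of them. *)
Lemma peeling (F : {set {set T}}) (r a s : nat) (S : {set T}) :
    antichain F -> (forall A, A \in F -> #|A| <= r) ->
    (forall A, A \in F -> {in A &, forall x y, x != y -> g x y}) ->
    s <= #|S| -> (forall S' : {set T}, S' \subset S -> s < #|S'| -> ~~ mindeg S' a.+1) ->
  #|[set A in F | A \subset S]| <= antichain_bound r s + (#|S| - s) * antichain_bound r.-1 a.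
Proof.
move=> acF leF clF; have [n] := ubnP #|S|; elim: n S => // n IHn S ltSn leS sparse.
have [ltS|] := ltnP s #|S|; last first.
  move=> geS; have -> : s = #|S| by apply/eqP; rewrite eqn_leq leS.
  rewrite subnn addn0; apply: sperner.
  - by move=> A B; rewrite !inE => /andP[AF _] /andP[BF _]; apply: acF.
  - by move=> A; rewrite inE => /andP[].
  - by move=> A; rewrite inE => /andP[/leF].
have /forall_inPn[v vS] := sparse S (subxx S) ltS.
rewrite -ltnNge ltnS => degv.
have cardSv : #|S| = (#|S :\ v|).+1 by rewrite (cardsD1 v S) vS.
apply: leq_trans (card_remove_vertex (v := v) acF leF degv _) _.
  move=> A AF AS vA; apply/subsetP=> z; rewrite !inE => /andP[zv zA].
  by rewrite (subsetP AS) //= (clF A) // eq_sym.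
have ltSv : #|S :\ v| < n by rewrite -ltnS -cardSv.
have leSv : s <= #|S :\ v| by rewrite -ltnS -cardSv.
rewrite cardSv subSn //.
rewrite mulSnr addnA leq_add2r; apply: IHn => // S' S'S.
by apply: sparse; apply: subset_trans S'S (subsetDl _ _).
Qed.

End Degrees.

Definition no_long_cycle (T : eqType) (g : rel T) (k : nat) : Prop :=
  forall c : seq T, cycle g c -> uniq c -> size c < k.

Lemma clique_path (T : eqType) (g : rel T) x s :
  uniq (x :: s) -> {in x :: s &, forall y z, y != z -> g y z} -> path g x s.
Proof.
elim: s x => //= z s IHs x /and3P[xzs zs us] cl.
rewrite cl ?inE ?eqxx ?orbT //=; last by move: xzs; rewrite inE negb_or => /andP[].
apply: IHs => /=; first by rewrite zs.
by move=> y t yz tz; apply: cl; rewrite inE ?yz ?tz orbT.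
Qed.

Lemma clique_cycle (T : eqType) (g : rel T) s :
  1 < size s -> uniq s -> {in s &, forall y z, y != z -> g y z} -> cycle g s.
Proof.
case: s => // x s /= s_gt0 us cl; rewrite rcons_path clique_path //=.
apply: cl; rewrite ?mem_last ?mem_head //.
case: s s_gt0 us => //= z s _ /andP[xz _]; apply: contraNneq xz => <-; exact: mem_last.
Qed.

Definition add_edge (T : eqType) (g : rel T) (x y : T) : rel T :=
  fun u w => [|| g u w, (u == x) && (w == y) | (u == y) && (w == x)].

(** A cycle that needs the new edge becomes a path between the ends of that edge
    when it is cut there. *)
Lemma add_edge_cycle (T : finType) (g : rel T) x y c : symmetric g ->
    cycle (add_edge g x y) c -> uniq c -> 2 < size c -> ~~ cycle g c ->
  exists p, [/\ path g x p, uniq (x :: p), last x p = y & size c = size (x :: p)].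
Proof.
move=> gsym cyc uc sc ncyc.
have [i [w [q [Er ngw]]]] : exists i w q, rot i c = w :: q /\ ~~ g (last w q) w.
  case: c ncyc {cyc uc sc} => // a s.
  rewrite -[cycle _ _]/(sorted g (rcons (a :: s) a)) => /not_sorted_step[l [u [v [r [Es nguv]]]]].
  case: (lastP r) Es => [|r' z] Es.
    have /rcons_inj[Es' av] : rcons (a :: s) a = rcons (rcons l u) v.
      by rewrite Es -!cats1 -catA.
    have la : last a s = u by have /(congr1 (last a)) := Es'; rewrite last_rcons.
    by exists 0, a, s; rewrite rot0 la; split=> //; rewrite [in X in g _ X]av.
  have /rcons_inj[Es' _] : rcons (a :: s) a = rcons (l ++ u :: v :: r') z.
    by rewrite Es rcons_cat.
  exists (size (rcons l u)), v, (r' ++ rcons l u).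
  by rewrite Es' -cat_rcons rot_size_cat last_cat last_rcons.
move: cyc uc sc; rewrite -(rot_cycle i) -(rot_uniq i) -(size_rot i) Er => cyc uq sq.
have [pq guw] : path (add_edge g x y) w q /\ add_edge g x y (last w q) w.
  by move: cyc; rewrite /= rcons_path => /andP.
set u := last w q in ngw guw.
have uwxy : (u == x) && (w == y) || (u == y) && (w == x).
  by move: guw; rewrite /add_edge (negPf ngw).
have pgq : path g w q.
  apply/negP=> /negP/(@not_sorted_step _ g (w :: q))[l [a [b [r [Eq nab]]]]].
  have abwu : (a == w) && (b == u) || (a == u) && (b == w).
    have : add_edge g x y a b.
      have : sorted (add_edge g x y) (w :: q) by [].
      by rewrite Eq; move/cat_sorted2=> [_] /= /andP[].
    rewrite /add_edge (negPf nab) /=.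
    case/orP: uwxy => /andP[/eqP-> /eqP->]; by rewrite // orbC.
  have lst : last a (b :: r) = u by rewrite /u; have /(congr1 (last w)) := Eq; rewrite last_cat /= => ->.
  case/orP: abwu => /andP[/eqP aw /eqP bu].
    case: l Eq => [[_ Eq]|w' l [ww Eq]]; last first.
      by move: uq; rewrite /= Eq aw mem_cat mem_head orbT.
    move: uq sq; rewrite Eq /= => /and3P[_ br _]; move: lst; rewrite bu /=.
    case: (r) br => //= z r' br lst; move: br; by rewrite bu -lst mem_last.
  case: l Eq => [[wa Eq]|w' l [ww Eq]]; last first.
    by move: uq; rewrite /= Eq bu mem_cat !inE eqxx !orbT.
  by move: uq; rewrite /= Eq bu mem_head.
case/orP: uwxy => /andP[/eqP uy /eqP wx]; last first.
  by exists q; rewrite -wx -uy.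
have [p [Ep pp lp]] := rev_walk gsym pgq.
exists p; rewrite -uy -wx; split=> //.
  by rewrite -Ep rev_uniq.
by rewrite -Ep size_rev.
Qed.
Section Kopylov.
Variables (T : finType) (U : {set T}) (k : nat).
Hypothesis k_gt4 : 4 < k.

Definition graph_on (g : rel T) : Prop :=
  [/\ symmetric g, irreflexive g, forall x y, g x y -> x \in U
    & forall z, connected_on g (U :\ z)].

Definition long_path (g : rel T) x y : Prop :=
  exists p, [/\ path g x p, uniq (x :: p), last x p = y & k <= size (x :: p)].

(** Among the paths with at least k vertices from X to Y with nonadjacent ends, take a
    longest one.  Every neighbour in X of its first vertex lies on it, since
    otherwise the path could be extended to that neighbour, or closed through it
    to a long cycle; the same holds for Y and the last vertex.  Then
    [posa_cycle] yields a cycle of length at least k. *)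
Lemma completely_joined g (X Y : {set T}) a b :
    graph_on g -> no_long_cycle g k ->
    {in U &, forall x y, x != y -> ~~ g x y -> long_path g x y} ->
    X \subset U -> Y \subset U -> mindeg g X a -> mindeg g Y b -> k <= a + b ->
  forall x y, x \in X -> y \in Y -> x != y -> g x y.
Proof.
move=> [gsym girr gU conn] nolong maxl XU YU /mindegP degX /mindegP degY le_k.
suff nopath x y p : x \in X -> y \in Y -> x != y -> ~~ g x y ->
    path g x p -> uniq (x :: p) -> last x p = y -> k <= size (x :: p) -> False.
  move=> x y xX yY xy; apply/negPn/negP=> nxy.
  have [p [pp up lp sp]] := maxl _ _ (subsetP XU _ xX) (subsetP YU _ yY) xy nxy.
  exact: nopath pp up lp sp.
have [n] := ubnP (#|T| - size p); elim: n x y p => // n IHn x y p ltn xX yY xy nxy pp up lp kp.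
have szp : size p < #|T| by rewrite -[(size p).+1]/(size (x :: p)) -(card_uniqP up) max_card.
have subX : [set z in X | g x z] \subset [set z in x :: p | g x z].
  apply/subsetP=> z; rewrite !inE => /andP[zX gxz]; rewrite gxz andbT -in_cons.
  apply/negPn/negP=> zp.
  have upz : uniq [:: z, x & p] by rewrite cons_uniq zp.
  have ppz : path g z (x :: p) by rewrite /= gsym gxz.
  have zy : z != y by apply: contraNneq zp => ->; rewrite -lp mem_last.
  have [gzy|ngzy] := boolP (g z y).
    suff /nolong/(_ upz) : cycle g [:: z, x & p] by rewrite /= ltnNge ltnW // ltnW.
    by rewrite -[cycle _ _]/(path g z (rcons (x :: p) z)) rcons_path ppz /= lp gsym.
  apply: (IHn z y (x :: p)) => //; last by rewrite /= ltnW.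
  by move: ltn szp; clear => /=; lia.
have subY : [set z in Y | g y z] \subset [set z in x :: p | g y z].
  apply/subsetP=> z; rewrite !inE => /andP[zY gyz]; rewrite gyz andbT -in_cons.
  apply/negPn/negP=> zp.
  have upz : uniq (x :: rcons p z) by rewrite -rcons_cons rcons_uniq zp.
  have ppz : path g x (rcons p z) by rewrite rcons_path pp lp.
  have zx : x != z by apply: contraNneq zp => <-; rewrite mem_head.
  have [gxz|ngxz] := boolP (g x z).
    suff /nolong/(_ upz) : cycle g (x :: rcons p z).
      by rewrite /= size_rcons ltnNge ltnW // ltnW.
    by rewrite -[cycle _ _]/(path g x (rcons (rcons p z) x)) rcons_path ppz /= last_rcons gsym.
  apply: (IHn x z (rcons p z)) => //; last by rewrite /= size_rcons ltnW.
    by move: ltn szp; clear; rewrite size_rcons; lia.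
  by rewrite last_rcons.
have [|||c [cc uc]] := posa_cycle gsym girr gU conn pp up _ _ kp.
- by rewrite lp.
- by rewrite lp.
- apply: leq_trans le_k _; rewrite lp -!card_set_filter //; apply: leq_add.
    by apply: leq_trans (subset_leq_card subX); apply: degX.
  by apply: leq_trans (subset_leq_card subY); apply: degY.
by rewrite leqNgt nolong.
Qed.

Lemma mindeg2 g : graph_on g -> 2 < #|U| -> mindeg g U 2.
Proof.
move=> [gsym girr gU conn] U_gt2; apply/mindegP=> y yU.
have nbr z : z != y -> exists2 w, g y w & w != z.
  move=> zy; have [w] : exists w, w \in U :\ z :\ y.
    apply/set0Pn; rewrite -card_gt0; move: U_gt2.
    by rewrite (cardsD1 y) yU (cardsD1 z) setDDl setUC -setDDl; case: (z \in _) => /=; lia.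
  rewrite !inE => /and3P[wy wz wU].
  have yU' : y \in U :\ z by rewrite !inE eq_sym zy.
  have wU' : w \in U :\ z by rewrite !inE wz.
  have [p pp [lp _ sp]] := connect_restr_path (conn z _ _ yU' wU').
  case: p pp lp sp => [_ yw|v p /= /andP[gyv _] _ sp]; first by rewrite -yw eqxx in wy.
  by exists v => //; have := sp v (mem_head _ _); rewrite !inE => /andP[].
have [z zy] : exists z, z != y.
  have : 0 < #|U :\ y| by move: U_gt2; rewrite (cardsD1 y) yU; lia.
  by case/card_gt0P=> z; rewrite !inE => /andP[zy _]; exists z.
have [w gyw _] := nbr z zy.
have wy : w != y by apply: contraTneq gyw => ->; rewrite girr.
have [w' gyw' w'w] := nbr w wy.
have <- : #|[set w; w']| = 2 by rewrite cards2 eq_sym w'w.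
apply: subset_leq_card; apply/subsetP=> v; rewrite !inE => /orP[] /eqP->.
  by rewrite gyw andbT; apply: (gU _ y); rewrite gsym.
by rewrite gyw' andbT; apply: (gU _ y); rewrite gsym.
Qed.

(** If the bound fails for a, then [peeling] gets stuck at a set of more than
    k - a vertices with all inner degrees above a.  Let K be a largest set with
    inner degrees above t = (k - 1)/2.  By [completely_joined] it is a clique,
    with k - t < |K| < k, and it is completely joined to the set M on which the
    peeling for a = k - |K| gets stuck (if |K| = k - 1, to the whole graph, whose degrees are
    at least 2).  As M has more than |K| vertices, K can be
    enlarged by a vertex of M, which contradicts the choice of K. *)
Lemma kopylov_maximal g (F : {set {set T}}) r :
    graph_on g -> no_long_cycle g k ->
    {in U &, forall x y, x != y -> ~~ g x y -> long_path g x y} ->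
    k <= #|U| -> antichain F -> (forall A, A \in F -> A \subset U) ->
    (forall A, A \in F -> #|A| <= r) ->
    (forall A, A \in F -> {in A &, forall x y, x != y -> g x y}) ->
  exists a, [/\ 2 <= a, a <= k.-1./2 &
    #|F| <= antichain_bound r (k - a) + (#|U| - (k - a)) * antichain_bound r.-1 a].
Proof.
move=> Gg nolong maxl le_kn acF FU leF clF.
have gsym : symmetric g by case: Gg.
apply: NNPP => contra; set t := k.-1./2.
have dense a : 2 <= a <= t ->
    exists S : {set T}, [/\ S \subset U, k - a < #|S| & mindeg g S a.+1].
  case/andP=> a2 at_; apply: NNPP => noS; case: contra; exists a; split=> //.
  have -> : F = [set A in F | A \subset U].
    by apply/setP=> A; rewrite inE; case: (boolP (A \in F)) => //= /FU ->.
  apply: (peeling acF leF clF); first by lia.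
  by move=> S SU ltS; apply/negP=> dS; apply: noS; exists S.
have t2 : 2 <= t by rewrite /t; lia.
have kt : k <= 2 * t + 2 /\ 2 * t < k by rewrite /t; lia.
have [St [StU ltSt dSt]] := dense t ltac:(by rewrite t2 leqnn).
pose core := [pred S : {set T} | (S \subset U) && mindeg g S t.+1].
have coreSt : core St by rewrite /= StU.
have [K /andP[KU dK] maxK] := @arg_maxnP _ St core (fun S => #|S|) coreSt.
have clK : {in K &, forall x y, x != y -> g x y}.
  move=> x y xK yK; apply: (completely_joined Gg nolong maxl KU KU dK dK) => //.
  by clear -kt; lia.
have ltK : k - t < #|K| by apply: leq_trans ltSt _; apply: maxK.
have ltKk : #|K| < k.
  rewrite cardE; apply: nolong; last exact: enum_uniq.
  apply: clique_cycle; rewrite ?enum_uniq -?cardE //; first by clear -ltK kt t2; lia.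
  by move=> x y; rewrite !mem_enum; apply: clK.
have dK' : mindeg g K #|K|.-1.
  apply/mindegP=> x xK; rewrite (cardsD1 x) xK /=; apply: subset_leq_card.
  by apply/subsetP=> z; rewrite !inE => /andP[zx zK]; rewrite zK clK // eq_sym.
have [M [MU ltM dM]] : exists M : {set T}, [/\ M \subset U, #|K| < #|M| & mindeg g M (k - #|K|).+1].
  have [K1|K2] := eqVneq (k - #|K|) 1.
    by exists U; rewrite K1; split; [exact: subxx | clear -ltKk le_kn; lia | apply: mindeg2 => //; clear -k_gt4 le_kn; lia].
  have [|M [MU ltM dM]] := dense (k - #|K|); first by clear -ltK ltKk kt K2; lia.
  by exists M; split=> //; clear -ltM ltKk; lia.
have [y yM yK] : exists2 y, y \in M & y \notin K.
  by apply/subsetPn; apply: contraL ltM => /subset_leq_card; rewrite -leqNgt.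
have joined x : x \in K -> g x y.
  move=> xK; apply: (completely_joined Gg nolong maxl KU MU dK' dM) => //; first by clear -ltK ltKk kt t2; lia.
  by apply: contraNneq yK => <-.
have : core (y |: K).
  rewrite /= subUset sub1set (subsetP MU) // KU /=; apply/mindegP=> x /setU1P[->|xK].
    apply: (@leq_trans #|K|); first by clear -ltK kt; lia.
    apply: subset_leq_card; apply/subsetP=> z zK; rewrite !inE zK orbT gsym; exact: joined.
  apply: leq_trans (mindegP _ _ _ dK x xK) _; apply: subset_leq_card.
  by apply/subsetP=> z; rewrite !inE => /andP[-> ->]; rewrite orbT.
by move/maxK; rewrite cardsU1 yK; clear; lia.
Qed.

(** Adding edges keeps the members of F cliques, so the graph may be assumed
    edge-maximal without long cycles. *)
Lemma kopylov g (F : {set {set T}}) r :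
    graph_on g -> no_long_cycle g k ->
    k <= #|U| -> antichain F -> (forall A, A \in F -> A \subset U) ->
    (forall A, A \in F -> #|A| <= r) ->
    (forall A, A \in F -> {in A &, forall x y, x != y -> g x y}) ->
  exists a, [/\ 2 <= a, a <= k.-1./2 &
    #|F| <= antichain_bound r (k - a) + (#|U| - (k - a)) * antichain_bound r.-1 a].
Proof.
move=> Gg nolong le_kn acF FU leF clF; move: Gg nolong clF.
have [n] := ubnP #|[set u : T * T | ~~ g u.1 u.2]|.
elim: n g => // n IHn g ltn Gg nolong clF.
have [maxl|] := classic {in U &, forall x y, x != y -> ~~ g x y -> long_path g x y}.
  exact: (kopylov_maximal Gg).
move=> nmax; have [x [y [xU yU xy nxy nlp]]] :
    exists x y, [/\ x \in U, y \in U, x != y, ~~ g x y & ~ long_path g x y].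
  apply: NNPP => h; apply: nmax => x y xU yU xy nxy; apply: NNPP => nlp.
  by apply: h; exists x, y.
have [gsym girr gU conn] := Gg.
have gsub u w : g u w -> add_edge g x y u w by rewrite /add_edge => ->.
apply: (IHn (add_edge g x y)).
- rewrite -ltnS; apply: leq_trans ltn; rewrite ltnS; apply: proper_card; apply/properP; split.
    by apply/subsetP=> u; rewrite !inE; apply: contra; apply: gsub.
  by exists (x, y); rewrite !inE //= /add_edge !eqxx orbT.
- split.
  + by move=> u w; rewrite /add_edge gsym; congr (_ || _); rewrite orbC [(w == x) && _]andbC [(w == y) && _]andbC.
  + move=> u; rewrite /add_edge girr /=; apply/negP=> /orP[] /andP[/eqP-> /eqP e]; by rewrite e eqxx in xy.
  + by move=> u w /or3P[/gU //|/andP[/eqP-> _]|/andP[/eqP-> _]].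
  move=> z u w uU wU; apply: connect_sub (conn z u w uU wU) => v1 v2 /and3P[v1U v2U gv].
  by apply: connect1; apply/and3P; split=> //; apply: gsub.
- move=> c cc uc; have [cg|ncg] := boolP (cycle g c); first exact: nolong.
  rewrite ltnNge; apply/negP=> kc; apply: nlp.
  have [|p [pp up lp sp]] := add_edge_cycle gsym cc uc _ ncg; first by lia.
  by exists p; rewrite -sp.
by move=> A AF u w uA wA uw; apply: gsub; apply: clF AF _ _ _ _ _.
Qed.
End Kopylov.

(** * From hypergraphs to their shadow graphs *)

Section Hall.
Variables (J I : finType) (i0 : I).
Implicit Types (N : J -> {set I}) (D S : {set J}).

Definition hall_condition N D : Prop :=
  forall S, S \subset D -> #|S| <= #|\bigcup_(j in S) N j|.

(** The induction of Halmos and Vaughan: a tight proper subset is matched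
    separately from its complement; without one, any single choice for j0 leaves
    the condition intact for the other elements. *)
Lemma hall N D : hall_condition N D ->
  exists f : J -> I, {in D &, injective f} /\ forall j, j \in D -> f j \in N j.
Proof.
have [n] := ubnP #|D|; elim: n N D => // n IHn N D ltn hallD.
have [->|[j0 j0D]] := set_0Vmem D.
  by exists (fun=> i0); split=> j; rewrite inE.
have [[S [S0 SD tight]]|loose] := classic (exists S,
    [/\ S != set0, S \proper D & #|\bigcup_(j in S) N j| <= #|S|]).
  have sSD := proper_sub SD.
  have [|A AS|f1 [inj1 f1N]] := IHn N S.
  - by rewrite -ltnS; apply: leq_trans ltn; rewrite ltnS; apply: proper_card.
  - by apply: hallD; apply: subset_trans sSD.
  pose N' j := N j :\: \bigcup_(j' in S) N j'.
  have [|A AS|f2 [inj2 f2N]] := IHn N' (D :\: S).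
  - rewrite -ltnS; apply: leq_trans ltn; rewrite ltnS; apply: proper_card; apply/properP.
    split; first exact: subsetDl.
    by case/set0Pn: S0 => j jS; exists j; rewrite ?(subsetP sSD) // inE jS.
  - have dAS : [disjoint A & S].
      by apply: disjointWl AS _; rewrite disjoint_sym disjoints_subset setCD setUC subsetUl.
    have := hallD (S :|: A) _; rewrite subUset sSD (subset_trans AS (subsetDl _ _)) => /(_ isT).
    rewrite cardsU disjoint_setI0 1?disjoint_sym // cards0 subn0 bigcup_setU.
    have -> : \bigcup_(j in A) N' j = (\bigcup_(j in A) N j) :\: \bigcup_(j' in S) N j'.
      apply/setP=> i; rewrite in_setD; apply/bigcupP/andP.
        by case=> j jA; rewrite in_setD => /andP[iS iN]; split=> //; apply/bigcupP; exists j.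
      by case=> iS /bigcupP[j jA iN]; exists j; rewrite // in_setD iS.
    set X := \bigcup_(j in S) N j in tight *; set Y := \bigcup_(j in A) N j.
    have -> : #|X :|: Y| = #|X| + #|Y :\: X|.
      by rewrite -[LHS](cardsID X) setIC (setIidPl (subsetUl X Y)) setDUl setDv set0U.
    by move: tight; clear; lia.
  exists (fun j => if j \in S then f1 j else f2 j); split=> [j j' jD j'D|j jD]; last first.
    case: ifP => [/f1N //|/negbT jS].
    by have := f2N j; rewrite !inE jS jD => /(_ isT)/andP[].
  have notS l l' : l \in S -> l' \in D -> l' \notin S -> f1 l != f2 l'.
    move=> lS l'D l'S; have := f2N l'; rewrite in_setD l'S l'D => /(_ isT).
    rewrite in_setD => /andP[+ _]; apply: contraNneq => <-.
    by apply/bigcupP; exists l; rewrite ?f1N.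
  case: ifPn => jS; case: ifPn => j'S.
  - exact: inj1.
  - by move/eqP; rewrite (negPf (notS _ _ _ _ _)).
  - by move/eqP; rewrite eq_sym (negPf (notS _ _ _ _ _)).
  - by apply: inj2; rewrite in_setD ?jS ?j'S.
have [i1 i1N] : exists i, i \in N j0.
  have := hallD [set j0]; rewrite sub1set j0D cards1 big_set1 => /(_ isT).
  by case/card_gt0P=> i; exists i.
have [|A AD|f [injf fN]] := IHn (fun j => N j :\ i1) (D :\ j0).
- by move: ltn; rewrite (cardsD1 j0) j0D.
- have [->|A0] := eqVneq A set0; first by rewrite cards0.
  have AD' : A \proper D.
    apply/properP; split; first by apply: subset_trans AD (subsetDl _ _).
    by exists j0 => //; apply/negP=> /(subsetP AD); rewrite !inE eqxx.
  have lt : #|A| < #|\bigcup_(j in A) N j|.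
    by rewrite ltnNge; apply/negP=> le; apply: loose; exists A.
  have -> : \bigcup_(j in A) (N j :\ i1) = (\bigcup_(j in A) N j) :\ i1.
    apply/setP=> i; rewrite in_setD1; apply/bigcupP/andP.
      by case=> j jA; rewrite in_setD1 => /andP[ii iN]; split=> //; apply/bigcupP; exists j.
    by case=> ii /bigcupP[j jA iN]; exists j; rewrite // in_setD1 ii.
  by move: lt; rewrite (cardsD1 i1 (\bigcup_(j in A) N j)); case: (_ \in _); clear; lia.
exists (fun j => if j == j0 then i1 else f j); split=> [j j' jD j'D|j jD]; last first.
  case: eqP => [->//|/eqP jj].
  by have := fN j; rewrite !inE jj jD => /(_ isT)/andP[].
have ne l : l \in D -> l != j0 -> f l != i1.
  by move=> lD ll; have := fN l; rewrite !inE ll lD => /(_ isT)/andP[].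
case: eqP => [->|/eqP jj]; case: eqP => [->//|/eqP jj'].
- by move=> e; move: (ne _ j'D jj'); rewrite -e eqxx.
- by move=> e; move: (ne _ jD jj); rewrite e eqxx.
- by apply: injf; rewrite !inE ?jj ?jj'.
Qed.

Local Open Scope ring_scope.

(** Give each incidence of j with a member of N j the weight 1 / |N j|.  Every j
    receives total weight 1, and the total weight at each i is at most 1. *)
Lemma hall_of_degrees N D :
    (forall j, j \in D -> N j != set0) ->
    (forall i j, j \in D -> i \in N j -> (#|[set j' in D | i \in N j']| <= #|N j|)%N) ->
  hall_condition N D.
Proof.
move=> N0 deg S SD; set X := \bigcup_(j in S) N j; rewrite -(ler_nat rat).
have <- : \sum_(j in S) \sum_(i in X | i \in N j) #|N j|%:R^-1 = #|S|%:R :> rat.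
  rewrite -sumr_const; apply: eq_bigr => j jS.
  rewrite (eq_bigl [in N j]) => [|i].
    rewrite sumr_const -[LHS]mulr_natr mulVf // pnatr_eq0 cards_eq0.
    by apply: N0; apply: (subsetP SD).
  by rewrite andb_idl // => iN; apply/bigcupP; exists j.
rewrite (exchange_big_dep [in X]) /=; last by move=> j i _ /andP[].
rewrite -sumr_const; apply: ler_sum => i iX.
have [j1 j1S iN1] := bigcupP iX.
pose d := #|[set j' in D | i \in N j']|.
have d_gt0 : (0 < d)%N by apply/card_gt0P; exists j1; rewrite inE iN1 (subsetP SD).
apply: (@le_trans _ _ (\sum_(j in S | i \in N j) d%:R^-1)).
  rewrite (eq_bigl (fun j => (j \in S) && (i \in N j))) => [|j]; last by rewrite iX.
  apply: ler_sum => j /andP[jS iN]; have jD := subsetP SD _ jS.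
  rewrite lef_pV2 ?posrE ?ltr0n ?ler_nat ?deg //.
  by rewrite card_gt0 N0.
rewrite sumr_const -[leLHS]mulr_natr mulrC ler_pdivrMr ?ltr0n // mul1r ler_nat.
apply: subset_leq_card; apply/subsetP=> j; rewrite !inE => /andP[jS ->].
by rewrite (subsetP SD).
Qed.
End Hall.

Section Shadow.
Variables (T I : finType) (b : I -> {set T}).

(** The hyperedges are indexed by I, so that they may coincide as sets after
    points have been deleted or identified. *)
Definition inc : rel (I + T) := fun p q =>
  match p, q with
  | inl i, inr y | inr y, inl i => y \in b i
  | _, _ => false
  end.

Definition berge_step : rel (T * I) := fun p q => (p.1 \in b p.2) && (q.1 \in b p.2).

(** A Berge cycle is coded by the cyclic sequence of its pairs of a vertex and
    the hyperedge that leads to the next vertex. *)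
Definition no_long_berge (k : nat) : Prop := forall s : seq (T * I),
  cycle berge_step s -> uniq (map fst s) -> uniq (map snd s) -> size s < k.

Definition shadow : rel T := fun x y => (x != y) && [exists i, (x \in b i) && (y \in b i)].

Lemma closed_next (c : seq T) (S : {set T}) x :
  uniq c -> x \in c -> x \in S -> (forall y, y \in c -> y \in S -> next c y \in S) ->
  {subset c <= S}.
Proof.
move=> uc xc xS cl.
have [i q Er] := rot_to xc.
have pq : path (frel (next c)) x q.
  have := cycle_next uc; rewrite -(rot_cycle i) Er /= rcons_path => /andP[] //.
have sq : {subset x :: q <= c} by move=> z; rewrite -Er mem_rot.
suff h : {subset x :: q <= S} by move=> z zc; apply: h; rewrite -Er mem_rot.
clear Er; elim: q x xc xS sq pq => [|z q IHq] x xc xS sq /=; first by move=> _ t; rewrite mem_seq1 => /eqP->.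
case/andP=> /eqP nz pq t; rewrite inE => /predU1P[->//|].
apply: IHq => //; first by apply: sq; rewrite !inE eqxx orbT.
  by rewrite -nz cl.
by move=> u uz; apply: sq; rewrite inE uz orbT.
Qed.

Variables (F : {set I}) (k : nat).
Hypothesis antiF : {in F &, forall i j, b i \subset b j -> i = j}.
Hypothesis coveredF : forall i v, 2 < #|b i| -> v \in b i ->
  i \in F /\ exists j, [/\ j \in F, j != i & b i :\ v \subset b j].
Hypotheses (ltk : forall i, #|b i| < k) (noberge : no_long_berge k) (k_gt2 : 2 < k).

(** A pair inside b i lies in b i and, for each further point v of b i, in the
    hyperedge that contains b i without v; these are distinct because F is an
    antichain.  So its degree is at least |b i| - 1, which is also the largest
    number of edges inside b i on a cycle that is not contained in b i.  Hall's
    theorem assigns distinct hyperedges to the edges of the cycle. *)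
Lemma shadow_no_long_cycle : no_long_cycle shadow k.
Proof.
move=> c cyc uc; rewrite ltnNge; apply/negP=> kc.
have [x0 x0c] : exists x, x \in c.
  case Ec: c kc => [|x s] kc; first by move: (leq_trans k_gt2 kc).
  by exists x; rewrite mem_head.
have step x : x \in c -> shadow x (next c x) by move=> xc; apply: next_cycle.
have [i0 _] : exists i : I, true.
  by have /andP[_ /existsP[i _]] := step x0 x0c; exists i.
pose N x := [set i | (x \in b i) && (next c x \in b i)].
pose D := [set x in c].
have deg i x : x \in D -> i \in N x -> #|[set y in D | i \in N y]| <= #|N x|.
  rewrite inE => xc iN; have [xi nxi] : x \in b i /\ next c x \in b i by move: iN; rewrite inE => /andP.
  have xnx : x != next c x by have /andP[] := step x xc.
  have ltb : #|[set y in D | i \in N y]| < #|b i|.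
    apply: proper_card; apply/properP; split.
      by apply/subsetP=> y; rewrite !inE => /and3P[].
    apply: NNPP => full; suff : size c <= #|b i| by rewrite leqNgt (leq_trans (ltk i)).
    rewrite -(card_uniqP uc); apply: subset_leq_card; apply/subsetP.
    apply: closed_next xi _ => // y yc yi; apply/negPn/negP=> nyi; apply: full.
    by exists y => //; rewrite !inE yi (negPf nyi) !andbF.
  have [b3|] := ltnP 2 #|b i|; last first.
    move=> b2; have : #|[set y in D | i \in N y]| <= 1 by rewrite -ltnS (leq_trans ltb).
    move/leq_trans; apply; apply/card_gt0P; by exists i.
  have iF : i \in F by have [] := coveredF b3 xi.
  have [phi phiP] : exists phi : T -> I, forall v, v \in b i ->
      [/\ phi v \in F, phi v != i & b i :\ v \subset b (phi v)].
    apply: (@fin_all_exists _ _ (fun v j => v \in b i -> [/\ j \in F, j != i & b i :\ v \subset b j])).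
    by move=> v; have [/(coveredF b3)[_ [j hj]]|] := boolP (v \in b i); [exists j | exists i].
  pose S := b i :\ x :\ next c x.
  have inj : {in S &, injective phi}.
    move=> v w; rewrite !inE => /and3P[_ _ vb] /and3P[_ _ wb] evw; apply/eqP/negPn/negP=> vw.
    have [vF vi sv] := phiP v vb; have [_ _ sw] := phiP w wb.
    case/negP: vi; apply/eqP/esym/antiF => //; apply/subsetP=> z zb.
    have [zv|zv] := eqVneq z v; last by apply: (subsetP sv); rewrite !inE zv.
    by rewrite evw; apply: (subsetP sw); rewrite !inE zv vw -zv.
  apply: leq_trans (_ : #|i |: phi @: S| <= _).
    rewrite cardsU1 card_in_imset //.
    have -> : i \notin phi @: S.
      by apply/imsetP=> -[v]; rewrite !inE => /and3P[_ _ vb] iv; have [_] := phiP v vb; rewrite -iv eqxx.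
    move: ltb; rewrite (cardsD1 x (b i)) xi (cardsD1 (next c x) (b i :\ x)) !inE eq_sym xnx nxi /=.
    rewrite -/S; clear; lia.
  apply: subset_leq_card; apply/subsetP=> j /setU1P[->//|/imsetP[v]].
  rewrite !inE => /and3P[vnx vx vb] ->; have [_ _ sv] := phiP v vb.
  by rewrite !(subsetP sv) // !inE ?xi ?nxi eq_sym ?vx ?vnx.
have [f [injf fN]] : exists f : T -> I, {in D &, injective f} /\ forall x, x \in D -> f x \in N x.
  apply: (hall i0); apply: hall_of_degrees => // x; rewrite inE => /step/andP[_ /existsP[i /andP[xi nxi]]].
  by apply/set0Pn; exists i; rewrite inE xi.
have : size [seq (x, f x) | x <- c] < k.
  apply: noberge; rewrite -?map_comp.
  - rewrite cycle_map; apply: cycle_from_next => // x xc.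
    have := fN x; rewrite !inE => /(_ xc)/andP[xi nxi].
    by rewrite /berge_step /= xi.
  - by rewrite (eq_map (g := id)) ?map_id.
  - rewrite (eq_map (g := f)) // map_inj_in_uniq // => x y xc yc; by apply: injf; rewrite inE.
by rewrite size_map ltnNge kc.
Qed.

Lemma shadow_clique i : {in b i &, forall x y, x != y -> shadow x y}.
Proof. by move=> x y xi yi xy; rewrite /shadow xy; apply/existsP; exists i; rewrite xi. Qed.

Definition nodes (U : {set T}) : {set I + T} :=
  [set p | match p with inl _ => true | inr y => y \in U end].

Lemma shadow_connected (U : {set T}) z :
  connected_on inc (nodes U :\ inr z) -> connected_on shadow (U :\ z).
Proof.
move=> conn x y xU yU.
pose S := [set w | connect (restr shadow (U :\ z)) x w].
pose S' := [set p : I + T | match p with inl i => [exists w in S, w \in b i] | inr w => w \in S end].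
have xS : x \in S by rewrite inE connect0.
have SU w : w \in S -> w \in U :\ z.
  by rewrite inE => /connect_restr_last[->|].
suff : (inr y : I + T) \in S' by rewrite !inE.
have inN w : w \in U :\ z -> (inr w : I + T) \in nodes U :\ inr z.
  by rewrite !inE.
have cxy : connect (restr inc (nodes U :\ inr z)) (inr x) (inr y) := conn _ _ (inN _ xU) (inN _ yU).
apply: (connect_ind_set cxy); first by rewrite inE.
case=> [i|w] [j|w'] //=; rewrite [_ \in S']inE => wS wN wi; rewrite [_ \in S']inE //=.
  have /exists_inP[v vS vi] := wS.
  have w'U : w' \in U :\ z by move: wN; rewrite !inE.
  have [<-//|vw] := eqVneq v w'.
  rewrite inE; apply: connect_step w'U (shadow_clique vi wi vw); last exact: SU.
  by move: vS; rewrite inE.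
by apply/exists_inP; exists w.
Qed.
End Shadow.

(** * Essential incidences *)

Section Avoid.
Variables (V : finType) (g : rel V).

Lemma connect_avoid (B : {set V}) x p c :
  x \in B -> connect (restr g B) x p -> ~~ connect (restr g B) x c ->
  connect (restr g (B :\ c)) x p.
Proof.
move=> xB cxp ncx.
pose S := [set q | connect (restr g B) x q && connect (restr g (B :\ c)) x q].
suff : p \in S by rewrite inE => /andP[].
apply: (connect_ind_set cxp); first by rewrite inE !connect0.
move=> u w; rewrite !inE => /andP[cu cu'] wB guw.
have uB : u \in B by case: (connect_restr_last cu) => [->|].
have cw : connect (restr g B) x w by apply: connect_step guw.
have nc q : connect (restr g B) x q -> q != c by apply: contraTneq => ->.
by rewrite cw (connect_step cu') // !inE ?uB ?wB nc.
Qed.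

(** Without u the vertex x no longer reaches y, so in the connected graph on A
    the part of A - u that is reached from x has a neighbour u.  If this part
    misses c, then x reaches u without c. *)
Lemma connect_to_cut (A : {set V}) x y u c :
  connected_on g A -> x \in A -> x != u -> y \in A -> u \in A -> u != c ->
  ~~ connect (restr g (A :\ u)) x y -> ~~ connect (restr g (A :\ u)) x c ->
  connect (restr g (A :\ c)) x u.
Proof.
move=> conn xA xu yA uA uc ncy ncc; apply/negPn/negP=> ncu.
have xA' : x \in A :\ u by rewrite !inE xu.
suff : y \in [set q | connect (restr g (A :\ u)) x q] by rewrite inE (negPf ncy).
have cxy : connect (restr g A) x y := conn _ _ xA yA.
apply: (connect_ind_set cxy); first by rewrite inE connect0.
move=> p q; rewrite !inE => cp qA gpq.
have pA : p \in A :\ u by case: (connect_restr_last cp) => [->|].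
have [qu|qu] := eqVneq q u; last by apply: connect_step gpq => //; rewrite !inE qu.
case/negP: ncu; rewrite -qu.
have cp' : connect (restr g (A :\ c)) x p.
  apply: connect_restrS (connect_avoid xA' cp ncc).
  by apply/subsetP=> z; rewrite !inE => /and3P[-> _ ->].
apply: connect_step cp' _ _ gpq; last by rewrite !inE qu uc.
have : p != c by apply: contraNneq ncc => <-.
by move: pA; rewrite !inE => /andP[_ ->] ->.
Qed.
End Avoid.

Section Separation.
Variables (T I : finType) (b : I -> {set T}) (U : {set T}).

Lemma inc_sym : symmetric (inc b).
Proof. by case=> [i|x] [j|y]. Qed.

Definition biconnected : Prop :=
  connected_on (inc b) (nodes I U) /\ forall z, connected_on (inc b) (nodes I U :\ z).

(** In the graph without e, the node c cuts v off from all other points of e.  Then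
    c also cuts v off from e once v is deleted from e, which is the obstruction
    to this deletion. *)
Definition separates (e : I) (v : T) (c : I + T) : bool :=
  [&& c != inl e, c != inr v &
    [forall u in b e, (u != v) ==>
      ~~ connect (restr (inc b) (nodes I U :\ inl e :\ c)) (inr v) (inr u)]].

Hypotheses (bU : forall i, b i \subset U) (bicon : biconnected) (U_gt2 : 2 < #|U|).

Lemma inl_nodes i : inl i \in nodes I U. Proof. by rewrite inE. Qed.
Lemma inr_nodes x : (inr x \in nodes I U) = (x \in U). Proof. by rewrite inE. Qed.

Lemma edge_vertex i x : x \in b i -> x \in U.
Proof. exact: (subsetP (bU i)). Qed.

Lemma edge_size i : 1 < #|b i|.
Proof.
have first_step A y : connected_on (inc b) A -> inl i \in A -> inr y \in A ->
    exists2 x, x \in b i & inr x \in A.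
  move=> conn iA yA; have [p pp [lp _ sp]] := connect_restr_path (conn _ _ iA yA).
  case: p pp lp sp => // -[j|x] p //= /andP[xi _] _ sp.
  by exists x => //; apply: sp; rewrite mem_head.
have [y yU] : exists y, y \in U by apply/card_gt0P; apply: leq_trans U_gt2.
have [||u ui _] := first_step (nodes I U) y bicon.1; rewrite ?inE //.
have [w wU] : exists w, w \in U :\ u.
  by apply/card_gt0P; move: U_gt2; rewrite (cardsD1 u); case: (_ \in _); clear; lia.
have wN : inr w \in nodes I U :\ inr u by move: wU; rewrite !inE.
have [|x xi] := first_step _ w (bicon.2 (inr u)) _ wN; first by rewrite !inE.
rewrite !inE => /andP[xu _].
apply: leq_trans (_ : #|[set u; x]| <= _); first by rewrite cards2; have -> : u != x by apply: contraNneq xu => ->.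
by apply: subset_leq_card; apply/subsetP=> z; rewrite !inE => /orP[] /eqP->.
Qed.

(** The node c lies on the path from v through g to u. *)
Lemma separates_edge e v c u g :
    separates e v c -> u \in b e -> u != v -> v \in b g -> u \in b g -> g != e ->
  c = inl g \/ c = inr u.
Proof.
case/and3P=> ce cv /forall_inP sep ue uv vg ug ge; apply: NNPP => no.
have /implyP/(_ uv)/negP[] := sep u ue.
have cg : inl g != c by apply/eqP=> ceq; apply: no; left.
have cu : inr u != c by apply/eqP=> ceq; apply: no; right.
have vN : inr v \in nodes I U :\ inl e :\ c by rewrite !inE eq_sym cv /= (edge_vertex vg).
have gN : inl g \in nodes I U :\ inl e :\ c by rewrite !inE cg /= andbT; exact: ge.
have uN : inr u \in nodes I U :\ inl e :\ c by rewrite !inE cu /= (edge_vertex ug).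
have cvg : connect (restr (inc b) (nodes I U :\ inl e :\ c)) (inr v) (inl g).
  exact: connect_step (connect0 _ _) vN gN vg.
exact: connect_step cvg gN uN ug.
Qed.

Lemma separates_edges e v c u g y g' :
    separates e v c -> u \in b e -> u != v ->
    v \in b g -> y \in b g -> y \in b g' -> u \in b g' -> g != e -> g' != e ->
  [\/ c = inl g, c = inr y, c = inl g' | c = inr u].
Proof.
case/and3P=> ce cv /forall_inP sep ue uv vg yg yg' ug' ge ge'; apply: NNPP => no.
have /implyP/(_ uv)/negP[] := sep u ue.
have cg : inl g != c by apply/eqP=> ceq; apply: no; constructor 1.
have cy : inr y != c by apply/eqP=> ceq; apply: no; constructor 2.
have cg' : inl g' != c by apply/eqP=> ceq; apply: no; constructor 3.
have cu : inr u != c by apply/eqP=> ceq; apply: no; constructor 4.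
set N := nodes I U :\ inl e :\ c.
have vN : inr v \in N by rewrite !inE eq_sym cv /= (edge_vertex vg).
have gN : inl g \in N by rewrite !inE cg /= andbT; exact: ge.
have yN : inr y \in N by rewrite !inE cy /= (edge_vertex yg).
have gN' : inl g' \in N by rewrite !inE cg' /= andbT; exact: ge'.
have uN : inr u \in N by rewrite !inE cu /= (edge_vertex ug').
have c1 : connect (restr (inc b) N) (inr v) (inl g) by exact: connect_step (connect0 _ _) vN gN vg.
have c2 : connect (restr (inc b) N) (inr v) (inr y) by exact: connect_step c1 gN yN yg.
have c3 : connect (restr (inc b) N) (inr v) (inl g') by exact: connect_step c2 yN gN' yg'.
exact: connect_step c3 gN' uN ug'.
Qed.

(** Let w be a third point of e.  In the graph without e and u, the parts of v
    and of w are disjoint, since u separates v; both touch u.  The separator c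
    of u misses one of them, and through that part u reaches v or w without c. *)
Lemma separator_not_essential e v u c :
    2 < #|b e| -> v \in b e -> u \in b e -> separates e v (inr u) -> separates e u c -> False.
Proof.
move=> e3 ve ue sv su.
have uv : u != v by case/and3P: sv.
have [w we [wu wv]] : exists2 w, w \in b e & w != u /\ w != v.
  have : 0 < #|b e :\ u :\ v|.
    by move: e3; rewrite (cardsD1 u) ue (cardsD1 v (_ :\ _)) !inE eq_sym uv ve; clear; lia.
  by case/card_gt0P=> w; rewrite !inE => /and3P[wv wu we]; exists w.
case/and3P: sv => _ _ /forall_inP sepv; case/and3P: su => ce cu /forall_inP sepu.
have vu : v != u by rewrite eq_sym.
have {}sepv : ~~ connect (restr (inc b) (nodes I U :\ inl e :\ inr u)) (inr v) (inr w).
  exact: (implyP (sepv w we) wv).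
have conn := bicon.2 (inl e).
have inN x : x \in b e -> inr x \in nodes I U :\ inl e by move=> xe; rewrite !inE (edge_vertex xe).
have [ccv|ncv] := boolP (connect (restr (inc b) (nodes I U :\ inl e :\ inr u)) (inr v) c).
  have /implyP/(_ wu)/negP[] := sepu w we.
  rewrite (connect_restr_sym inc_sym); apply: (connect_to_cut (y := inr v) conn) => //; try exact: inN.
  - by rewrite eq_sym.
  - by rewrite (connect_restr_sym inc_sym).
  apply/negP=> cwc; case/negP: sepv; apply: connect_trans ccv _.
  by rewrite (connect_restr_sym inc_sym).
have /implyP/(_ vu)/negP[] := sepu v ve.
rewrite (connect_restr_sym inc_sym); apply: (connect_to_cut (y := inr w) conn) => //; try exact: inN.
by rewrite eq_sym.
Qed.

End Separation.

(** The image of S when the points of R are identified with p. *)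
Definition collapse (T : finType) (R : {set T}) (p : T) (S : {set T}) : {set T} :=
  if [disjoint S & R] then S else p |: (S :\: R).

Section Collapse.
Variables (T : finType) (R : {set T}) (p : T).
Hypothesis pR : p \in R.
Implicit Types S : {set T}.

Lemma in_collapse S x : x != p -> (x \in collapse R p S) = (x \in S) && (x \notin R).
Proof.
move=> xp; rewrite /collapse; case: ifP => [dS|_]; last first.
  by rewrite !inE (negPf xp) andbC.
by case: (boolP (x \in S)) => // xS; rewrite (disjointFr dS xS).
Qed.

Lemma collapse_pt S : (p \in collapse R p S) = ~~ [disjoint S & R].
Proof.
rewrite /collapse; case: ifP => [dS|_]; last by rewrite !inE eqxx.
by apply/negP=> pS; have := disjointFr dS pS; rewrite pR.
Qed.

Lemma collapse_card S : #|collapse R p S| <= #|S|.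
Proof.
rewrite /collapse; case: ifP => // /negbT; rewrite -setI_eq0 => /set0Pn[x].
rewrite inE => /andP[xS xR]; rewrite cardsU1 (cardsD1 x S) xS.
apply: leq_add; first by case: (_ \notin _).
by apply: subset_leq_card; apply/subsetP=> z; rewrite !inE => /andP[zR ->]; rewrite andbT; apply: contraNneq zR => ->.
Qed.

Lemma collapse_sub S (U : {set T}) : S \subset U -> p \in U -> collapse R p S \subset U :\: (R :\ p).
Proof.
move=> SU pU; apply/subsetP=> x; have [->|xp] := eqVneq x p; first by rewrite !inE eqxx pU.
by rewrite in_collapse // !inE xp => /andP[/(subsetP SU) -> ->].
Qed.

Lemma collapse_subset S S' : collapse R p S \subset collapse R p S' ->
  (forall y, y \in S -> y \notin R -> y \in S') /\
  (forall x, x \in S -> x \in R -> exists2 u, u \in S' & u \in R).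
Proof.
move=> sub; split=> [y yS yR|x xS xR].
  have yp : y != p by apply: contraNneq yR => ->.
  by have := subsetP sub y; rewrite !in_collapse // yS yR => /(_ isT)/andP[].
have := subsetP sub p; rewrite !collapse_pt => /(_ _)/wrap[].
  by rewrite -setI_eq0; apply/set0Pn; exists x; rewrite inE xS.
by rewrite -setI_eq0 => /set0Pn[u]; rewrite inE => /andP[uS uR]; exists u.
Qed.
End Collapse.

Section Structure.
Variables (T I : finType) (b : I -> {set T}) (U : {set T}) (F : {set I}).
Hypotheses (bU : forall i, b i \subset U) (bicon : biconnected b U) (U_gt2 : 2 < #|U|).
Hypothesis antiF : {in F &, forall i j, b i \subset b j -> i = j}.

(** Deletion of v from e would destroy the antichain. *)
Definition covered (e : I) (v : T) : Prop :=
  e \in F /\ exists j, [/\ j \in F, j != e & b e :\ v \subset b j].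

Variable e : I.
Hypothesis e3 : 2 < #|b e|.

(** The configuration at a hyperedge e one of whose points cannot be deleted for
    lack of connectivity only: E is a set of essential points with chosen
    separators outside e, and at most one point a of e is missing from E.  If
    there is such a point, the separators are all the same hyperedge. *)
Definition cut_system (E : {set T}) (cut : T -> I + T) : Prop :=
  [/\ E \subset b e, forall v, v \in E -> separates b U e v (cut v),
      forall u v, v \in E -> u \in b e -> cut v != inr u &
      E = b e \/ exists a j, [/\ a \in b e, b e :\ a \subset E, a \notin E &
        forall v, v \in E -> cut v = inl j]].

(** The uncovered point v0 is essential.  If two points a and a' were not, they would be
    covered by some j and j'.  The separator of v0 lies on the path v0, j, a'
    and on the path v0, j', a, so j = j', which then contains all of e.  If
    exactly one point a is not essential, then the separator of any other point
    v lies on a path v, j, u with u essential, and it is not u by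
    [separator_not_essential]. *)
Lemma cut_system_exists v0 :
    (forall v, v \in b e -> (exists c, separates b U e v c) \/ covered e v) ->
    v0 \in b e -> ~ covered e v0 ->
  exists E cut, cut_system E cut.
Proof.
move=> ess_or_cov v0e nc0.
pose E := [set v in b e | [exists c, separates b U e v c]].
have EP v : v \in b e -> v \notin E -> covered e v.
  by move=> ve vE; case: (ess_or_cov v ve) => // -[c sc]; case/negP: vE; rewrite inE ve; apply/existsP; exists c.
have v0E : v0 \in E by apply/negPn/negP=> /(EP _ v0e).
have [cut cutP] : exists cut : T -> I + T, forall v, v \in E -> separates b U e v (cut v).
  apply: (@fin_all_exists _ _ (fun v c => v \in E -> separates b U e v c)) => v.
  have [|_] := boolP (v \in E); last by exists (inl e).
  by rewrite inE => /andP[_ /existsP[c sc]]; exists c.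
have Ee : E \subset b e by apply/subsetP=> v; rewrite inE => /andP[].
clearbody E.
have cutE u v : v \in E -> u \in E -> cut v != inr u.
  move=> vE uE; apply/eqP=> cv; have := cutP v vE; rewrite cv => sv.
  exact: (separator_not_essential bU bicon e3 (subsetP Ee _ vE) (subsetP Ee _ uE) sv (cutP u uE)).
have [eE|] := boolP (b e \subset E).
  exists E, cut; split=> //; last by left; apply/eqP; rewrite eqEsubset Ee.
  by move=> u v vE /(subsetP eE); apply: cutE.
case/subsetPn=> a ae aE; have [eF [j [jF je sj]]] := EP a ae aE.
have others : b e :\ a \subset E.
  apply/subsetP=> a'; rewrite !inE => /andP[aa' a'e]; apply/negPn/negP=> a'E.
  have [_ [j' [j'F j'e sj']]] := EP a' a'e a'E.
  have v0a : v0 != a by apply: contraNneq aE => <-.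
  have v0a' : v0 != a' by apply: contraNneq a'E => <-.
  have inj x : x != a -> x \in b e -> x \in b j by move=> xa xe; apply: (subsetP sj); rewrite !inE xa.
  have inj' x : x != a' -> x \in b e -> x \in b j' by move=> xa xe; apply: (subsetP sj'); rewrite !inE xa.
  have aa : a != a' by rewrite eq_sym.
  have c1 := separates_edge bU (cutP v0 v0E) a'e _ (inj _ v0a v0e) (inj _ aa' a'e) je.
  have c2 := separates_edge bU (cutP v0 v0E) ae _ (inj' _ v0a' v0e) (inj' _ aa ae) j'e.
  have jj : j = j'.
    case: c1 => [|c1|c1]; first by rewrite eq_sym.
      by case: c2 => [|c2|c2]; [rewrite eq_sym | move: c2; rewrite c1 => -[] | move: c2; rewrite c1].
    case: c2 => [|c2|c2]; [by rewrite eq_sym | by move: c2; rewrite c1 |].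
    by move: c2; rewrite c1 => -[a'a]; rewrite a'a eqxx in aa.
  case/eqP: je; symmetry; apply: antiF => //; apply/subsetP=> z ze.
  have [za|za] := eqVneq z a; last exact: inj.
  by rewrite jj za; apply: inj'.
have cutj v : v \in E -> cut v = inl j.
  move=> vE; have ve := subsetP Ee _ vE.
  have [u [ue uv ua]] : exists u, [/\ u \in b e, u != v & u != a].
    have : 0 < #|b e :\ a :\ v|.
      by move: e3; rewrite (cardsD1 a) ae (cardsD1 v (_ :\ _)); case: (_ \in _ :\ _); clear; lia.
    by case/card_gt0P=> w; rewrite !inE => /and3P[wv wu we]; exists w.
  have va : v != a by apply: contraNneq aE => <-.
  have uE : u \in E by apply: (subsetP others); rewrite !inE ua.
  have [||cv|cv] := separates_edge bU (cutP v vE) ue uv _ _ je => //.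
  - by apply: (subsetP sj); rewrite !inE va.
  - by apply: (subsetP sj); rewrite !inE ua.
  by have := cutE u v vE uE; rewrite cv eqxx.
exists E, cut; split=> //.
  move=> u v vE ue; have [ua|ua] := eqVneq u a; first by rewrite cutj.
  by apply: cutE => //; apply: (subsetP others); rewrite !inE ua.
by right; exists a, j.
Qed.

Variables (E : {set T}) (cut : T -> I + T).
Hypothesis cutE : cut_system E cut.

(** The counted hyperedge to be sacrificed for the essential point v: its
    separator if that is a hyperedge, and otherwise the pair formed by v and
    the separator. *)
Definition lost (v : T) : {set I} :=
  [set i in F | (cut v == inl i) || [exists y, (cut v == inr y) && (b i == [set v; y])]].

Lemma card_lost v : #|lost v| <= 1.
Proof.
have sub i0 : (forall i, i \in lost v -> i = i0) -> #|lost v| <= 1.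
  move=> h; rewrite -(cards1 i0); apply: subset_leq_card.
  by apply/subsetP=> i /h ->; rewrite set11.
have [->|[i0 i0v]] := set_0Vmem (lost v); first by rewrite cards0.
apply: (sub i0) => i; move: i0v; rewrite !inE.
case: (cut v) => [c|c] /andP[i0F i0c] /andP[iF ic].
  case/orP: i0c => [/eqP[<-]|/existsP[y /andP[/eqP//]]].
  by case/orP: ic => [/eqP[<-]|/existsP[y /andP[/eqP//]]].
case/orP: i0c => [/eqP//|/existsP[y0 /andP[/eqP[<-] /eqP b0]]].
case/orP: ic => [/eqP//|/existsP[y /andP[/eqP[<-] /eqP bi]]].
by apply: antiF => //; rewrite b0 bi.
Qed.

(** When points of e are identified, g may become a subset of g' although x
    belongs to g only.  Any further point y of g then gives a path from x through
    g, y and g' (or directly through g) back to e, on which the separator of x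
    must lie.  If it is neither g nor g', it is y; so g has no other point. *)
Lemma collision x u g g' :
    x \in E -> g \in F -> g' \in F -> g != e -> g' != e ->
    x \in b g -> x \notin b g' -> u \in b g' -> u \in b e ->
    (forall y, y \in b g -> y \notin b e -> y \in b g') ->
  (g \in lost x) || (g' \in lost x).
Proof.
move=> xE gF g'F ge g'e xg xg' ug' ue sub.
have [Ee sep cutb _] := cutE.
apply/norP=> -[ng ng'].
have ncg : cut x <> inl g by move=> cx; case/negP: ng; rewrite inE gF cx eqxx.
have ncg' : cut x <> inl g' by move=> cx; case/negP: ng'; rewrite inE g'F cx eqxx.
have ux : u != x by apply: contraNneq xg' => <-.
have cx y : y \in b g -> y != x -> cut x = inr y.
  move=> yg yx; have [ye|ye] := boolP (y \in b e).
    case: (separates_edge bU (sep x xE) ye yx xg yg ge) => // cx.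
  case: (separates_edges bU (sep x xE) ue ux xg yg (sub y yg ye) ug' ge g'e) => // cx.
  by have := cutb u x xE ue; rewrite cx eqxx.
have [y] : exists y, y \in b g :\ x.
  apply/card_gt0P; have := edge_size bicon U_gt2 g.
  by rewrite (cardsD1 x) xg.
rewrite !inE => /andP[yx yg]; case/negP: ng; rewrite inE gF; apply/orP; right.
apply/existsP; exists y; rewrite (cx y yg yx) eqxx; apply/eqP/setP=> z; rewrite !inE.
apply/idP/orP=> [zg|[/eqP->//|/eqP->//]].
have [->|zx] := eqVneq z x; [by left | right].
by have := cx z zg zx; rewrite (cx y yg yx) => -[->].
Qed.

Definition all_lost : {set I} := \bigcup_(v in E) lost v.

Lemma card_all_lost (R : {set T}) : #|\bigcup_(v in R) lost v| <= #|R|.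
Proof.
rewrite -[leqRHS]sum1_card; apply: (big_ind2 (fun (S : {set I}) n => #|S| <= n)).
- by rewrite cards0.
- by move=> S m S' n leS leS'; apply: leq_trans (leq_card_setU _ _) (leq_add leS leS').
by move=> v _; apply: card_lost.
Qed.

(** Identify all points of e.  After e and the lost hyperedges have been dropped
    the images still form an antichain: if the offending point x is not
    essential, then it is the exceptional point a, and the path of [collision]
    is read from the other end, which is essential with a hyperedge as its
    separator. *)
Lemma count_full_contraction r :
    (forall i, #|b i| <= r) ->
  #|F| <= #|b e|.+1 + antichain_bound r (#|U| - #|b e|).+1.
Proof.
move=> le_r; have [Ee sep cutb shape] := cutE.
have [p pe] : exists p, p \in b e by apply/card_gt0P; apply: leq_trans e3.
pose F' := F :\: (e |: all_lost).
have leF : #|F| <= #|F'| + #|b e|.+1.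
  rewrite -(cardsID (e |: all_lost) F) addnC leq_add2l.
  apply: leq_trans (subset_leq_card (subsetIr _ _)) _; rewrite cardsU1 -add1n.
  apply: leq_add; first by case: (_ \notin _).
  exact: leq_trans (card_all_lost E) (subset_leq_card Ee).
have anti : {in F' &, forall g g', collapse (b e) p (b g) \subset collapse (b e) p (b g') -> g = g'}.
  move=> g g'; rewrite !inE !negb_or => /andP[/andP[ge gL] gF] /andP[/andP[g'e g'L] g'F] /collapse_subset[//|sub1 sub2].
  apply: antiF => //; apply/subsetP=> x xg; apply/negPn/negP=> xg'.
  have xe : x \in b e by apply/negPn/negP=> /(sub1 _ xg); rewrite (negPf xg').
  have [u ug' ue] := sub2 x xg xe.
  have inL v h : v \in E -> h \in lost v -> h \in all_lost by move=> vE hl; apply/bigcupP; exists v.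
  have [xE|xE] := boolP (x \in E).
    case/orP: (collision xE gF g'F ge g'e xg xg' ug' ue sub1) => /(inL _ _ xE).
      by rewrite (negPf gL).
    by rewrite (negPf g'L).
  case: shape => [Eb|[a [j [ae others aE cutj]]]]; first by rewrite Eb xe in xE.
  have xa : x = a by apply/eqP/negPn/negP=> xa; case/negP: xE; apply: (subsetP others); rewrite !inE xa.
  have ux : u != x by apply: contraNneq xg' => <-.
  have uE : u \in E by apply: (subsetP others); rewrite !inE -xa ux.
  have xu : x != u by rewrite eq_sym.
  have [y] : exists y, y \in b g :\ x.
    apply/card_gt0P; have := edge_size bicon U_gt2 g.
    by rewrite (cardsD1 x) xg.
  rewrite !inE => /andP[yx yg]; have [ye|ye] := boolP (y \in b e).
    have yE : y \in E by apply: (subsetP others); rewrite !inE -xa yx.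
    have xy : x != y by rewrite eq_sym.
    case: (separates_edge bU (sep y yE) xe xy yg xg ge) => cy; last first.
      by have := cutb x y yE xe; rewrite cy eqxx.
    by case/negP: gL; apply: (inL y) => //; rewrite inE gF cy eqxx.
  case: (separates_edges bU (sep u uE) xe xu ug' (sub1 _ yg ye) yg xg g'e ge) => cu.
  - by case/negP: g'L; apply: (inL u) => //; rewrite inE g'F cu eqxx.
  - by have := cutj u uE; rewrite cu.
  - by case/negP: gL; apply: (inL u) => //; rewrite inE gF cu eqxx.
  - by have := cutb x u uE xe; rewrite cu eqxx.
apply: leq_trans leF _; rewrite addnC leq_add2l.
have injF : {in F' &, injective (fun i => collapse (b e) p (b i))}.
  by move=> g g' gF g'F egg'; apply: anti => //; rewrite egg'.
rewrite -(card_in_imset injF).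
have cardU : #|U :\: (b e :\ p)| = (#|U| - #|b e|).+1.
  have eU := bU e; have := subset_leq_card eU.
  rewrite cardsDS ?(subset_trans (subsetDl _ _)) // (cardsD1 p (b e)) pe; clear; lia.
rewrite -cardU; apply: sperner.
- by move=> _ _ /imsetP[g gF ->] /imsetP[g' g'F ->] /(anti _ _ gF g'F) ->.
- by move=> _ /imsetP[g gF ->]; apply: collapse_sub => //; apply: (subsetP (bU e)).
by move=> _ /imsetP[g gF ->]; apply: leq_trans (collapse_card _ _ _) (le_r g).
Qed.
End Structure.

(** * Contraction and deletion *)

Lemma connected_on_image (V : finType) (g g' : rel V) (A A' : {set V}) (phi : V -> V) :
    connected_on g A ->
    (forall u, u \in A -> phi u \in A') ->
    (forall w, w \in A' -> exists2 u, u \in A & phi u = w) ->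
    (forall u w, u \in A -> w \in A -> g u w -> g' (phi u) (phi w)) ->
  connected_on g' A'.
Proof.
move=> conn inA' sur hom _ _ /sur[x xA <-] /sur[y yA <-].
have cxy : connect (restr g A) x y := conn _ _ xA yA.
suff : y \in [set q in A | connect (restr g' A') (phi x) (phi q)] by rewrite inE => /andP[].
apply: (connect_ind_set cxy); first by rewrite inE xA connect0.
move=> u w; rewrite !inE => /andP[uA cu] wA guw; rewrite wA /=.
exact: connect_step cu (inA' _ uA) (inA' _ wA) (hom _ _ uA wA guw).
Qed.

Section Contraction.
Variables (T I : finType) (b : I -> {set T}) (U : {set T}) (e : I).
Variables (R : {set T}) (v1 p : T) (cut : T -> I + T).
Hypotheses (bU : forall i, b i \subset U) (bicon : biconnected b U).
Hypotheses (be : b e = v1 |: R) (v1R : v1 \notin R) (pR : p \in R).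
Hypothesis sep : forall v, v \in R -> separates b U e v (cut v).
Hypothesis cutb : forall u v, v \in R -> u \in b e -> cut v != inr u.

(** This is what remains when the contracted point is removed.  Suppose a
    component K of the rest does not contain e, hence not v1 either.  In the graph without e and
    K, let W be the part of v1; as the graph without e is connected, W contains
    a point u of R with a neighbour in K.  The separator of u is not in K, because
    u reaches v1 within W.  But then u reaches through K another neighbour u'
    of K in R, which exists as K is not cut off from e by u alone; this
    contradicts the separation of u from u'. *)
Lemma contract_connected : connected_on (inc b) (nodes I (U :\: R)).
Proof.
set N0 := nodes I (U :\: R).
have csym := connect_restr_sym (inc_sym b).
have eN0 : inl e \in N0 by rewrite inE.
have v1e : v1 \in b e by rewrite be setU11.
have v1N0 : inr v1 \in N0 by rewrite !inE v1R (subsetP (bU e)).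
have Re u : u \in R -> u \in b e by move=> uR; rewrite be setU1r.
have Rnode u : u \in R -> inr u \in nodes I U by move=> uR; rewrite inE (subsetP (bU e)) ?Re.
have N0N q : q \in N0 -> q \in nodes I U by case: q => [i|x]; rewrite !inE // => /andP[].
have notN0 q : q \in nodes I U -> q \notin N0 -> exists2 u, u \in R & q = inr u.
  by case: q => [i|x]; rewrite !inE // => -> ; rewrite andbT negbK => xR; exists x.
suff toe x : x \in N0 -> connect (restr (inc b) N0) x (inl e).
  move=> x y xN yN; apply: connect_trans (toe x xN) _; rewrite csym; exact: toe.
move=> xN0; apply/negPn/negP=> nxe.
pose K := [set q | connect (restr (inc b) N0) x q].
have xK : x \in K by rewrite inE connect0.
have eK : inl e \notin K by rewrite inE.
have KN0 q : q \in K -> q \in N0.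
  by rewrite inE => /connect_restr_last[->|].
have stepK q q' : q \in K -> q' \in N0 -> inc b q q' -> q' \in K.
  move=> qK q'N gqq'; have := qK; rewrite !inE => cq.
  exact: connect_step cq (KN0 _ qK) q'N gqq'.
have v1K : inr v1 \notin K by apply: contra eK => v1K; apply: stepK v1K eN0 v1e.
pose Ne := nodes I U :\ inl e.
have v1Ne : inr v1 \in Ne :\: K by rewrite in_setD v1K !inE (subsetP (bU e)).
pose W := [set q | connect (restr (inc b) (Ne :\: K)) (inr v1) q].
have WN q : q \in W -> q \in Ne :\: K by rewrite inE => /connect_restr_last[->|].
have [u [uR uW [k1 k1K uk1]]] : exists u, [/\ u \in R, inr u \in W & exists2 k, k \in K & inc b (inr u) k].
  apply: NNPP => no.
  have xNe : x \in Ne by rewrite in_setD1 N0N // andbT; apply: contraNneq eK => <-.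
  have v1Ne' : inr v1 \in Ne by move: v1Ne; rewrite in_setD => /andP[].
  have cx : connect (restr (inc b) Ne) (inr v1) x := bicon.2 (inl e) _ _ v1Ne' xNe.
  suff /WN : x \in W by rewrite in_setD xK.
  apply: (connect_ind_set cx); first by rewrite inE connect0.
  move=> w q wW qNe gwq; have wN := WN w wW.
  have [qK|qK] := boolP (q \in K); last first.
    have := wW; rewrite !inE => cw.
    by apply: connect_step cw wN _ gwq; rewrite in_setD qK.
  move: wN; rewrite in_setD => /andP[wK]; rewrite in_setD1 => /andP[_ wU].
  have [wN0|wN0] := boolP (w \in N0).
    by case/negP: wK; apply: stepK qK wN0 _; rewrite inc_sym.
  have [u uR wu] := notN0 w wU wN0; case: no; exists u; rewrite -wu.
  by split=> //; exists q.
case/and3P: (sep uR) => ce cu /forall_inP sepu.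
have [cK|cK] := boolP (cut u \in K).
  have uv1 : v1 != u by apply: contraNneq v1R => ->.
  have /implyP/(_ uv1)/negP[] := sepu v1 v1e; rewrite csym.
  have : connect (restr (inc b) (Ne :\: K)) (inr v1) (inr u) by move: uW; rewrite inE.
  by apply: connect_restrS; apply/subsetP=> q; rewrite in_setD => /andP[qK qN]; rewrite in_setD1 qN andbT; apply: contraNneq qK => ->.
have [u' [u'R u'u [k2 k2K u'k2]]] : exists u', [/\ u' \in R, u' != u & exists2 k, k \in K & inc b k (inr u')].
  apply: NNPP => no; case/negP: eK.
  have xNu : x \in nodes I U :\ inr u.
    rewrite in_setD1 N0N // andbT; apply: contraTneq xN0 => ->.
    by rewrite !inE uR.
  have eNu : inl e \in nodes I U :\ inr u by rewrite !inE.
  have cx : connect (restr (inc b) (nodes I U :\ inr u)) x (inl e) := bicon.2 (inr u) _ _ xNu eNu.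
  apply: (connect_ind_set cx) => // q q' qK; rewrite in_setD1 => /andP[q'u q'N] gqq'.
  have [q'N0|q'N0] := boolP (q' \in N0); first exact: stepK qK q'N0 gqq'.
  have [u' u'R q'u'] := notN0 _ q'N q'N0; case: no; exists u'; split=> //.
    by apply: contraNneq q'u => <-; rewrite q'u'.
  by exists q; rewrite // -q'u'.
have /implyP/(_ u'u)/negP[] := sepu u' (Re _ u'R).
set M := _ :\ cut u.
have KM q : q \in K -> q \in M.
  move=> qK; rewrite !in_setD1 (N0N _ (KN0 _ qK)) andbT; apply/andP; split.
    by apply: contraNneq cK => <-.
  by apply: contraNneq eK => <-.
have uM : inr u \in M by rewrite !in_setD1 Rnode // eq_sym cu.
have u'M : inr u' \in M by rewrite !in_setD1 Rnode // eq_sym cutb ?Re.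
have c1 : connect (restr (inc b) M) (inr u) k1.
  exact: connect_step (connect0 _ _) uM (KM _ k1K) uk1.
have c2 : connect (restr (inc b) M) (inr u) k2.
  apply: connect_trans c1 _.
  have ck : connect (restr (inc b) N0) k1 k2.
    by apply: (connect_trans (y := x)); [rewrite csym|]; move: k1K k2K; rewrite !inE.
  suff : k2 \in [set q in K | connect (restr (inc b) M) k1 q] by rewrite inE => /andP[].
  apply: (connect_ind_set ck) => [|q q']; first by rewrite inE k1K connect0.
  rewrite inE => /andP[qK cq] q'N gqq'; have q'K := stepK _ _ qK q'N gqq'.
  by rewrite inE q'K; apply: connect_step cq (KM _ qK) (KM _ q'K) gqq'.
exact: connect_step c2 (KM _ k2K) u'M u'k2.
Qed.

Let b' i := collapse R p (b i).
Let U' := U :\: (R :\ p).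

(** Removing the contracted point is the case of [contract_connected]; removing any
    other node commutes with the contraction. *)
Lemma contract_biconnected : biconnected b' U'.
Proof.
pose phi (q : I + T) : I + T := if q is inr x then if x \in R then inr p else inr x else q.
have pU : p \in U by apply: (subsetP (bU e)); rewrite be setU1r.
have hom u w : inc b u w -> inc b' (phi u) (phi w).
  have h i x : x \in b i -> inc b' (phi (inl i)) (phi (inr x)).
    rewrite /phi /=; case: ifP => [xR xi|/negbT xR xi] /=.
      by rewrite collapse_pt // -setI_eq0; apply/set0Pn; exists x; rewrite inE xi.
    by rewrite in_collapse ?xi //; apply: contraNneq xR => ->.
  by case: u w => [i|x] [j|y] //= => [/h|]; rewrite // => /h; rewrite inc_sym.
have inU' x : (x \in U') = (x \in U) && ((x \notin R) || (x == p)).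
  by rewrite !inE negb_and negbK orbC andbC.
have phiN q : q \in nodes I U -> phi q \in nodes I U'.
  case: q => [i|x]; rewrite /phi ?inl_nodes ?inr_nodes // => xU.
  by case: ifP => [_|/negbT xR]; rewrite inr_nodes inU' ?pU ?eqxx ?orbT // xU xR.
have phi_id q : q \in nodes I U' -> phi q = q.
  case: q => // x; rewrite inr_nodes inU' /phi => /andP[_].
  by case: ifP => //= _ /eqP->.
have sub q : q \in nodes I U' -> q \in nodes I U.
  by case: q => [i|x]; rewrite !inE // => /andP[].
have whole : connected_on (inc b') (nodes I U').
  apply: (connected_on_image (phi := phi)) bicon.1 phiN _ (fun u w _ _ => hom u w) => w wN.
  by exists w; [apply: sub | apply: phi_id].
split=> // z; have [->|zp] := eqVneq z (inr p).
  have -> : nodes I U' :\ inr p = nodes I (U :\: R).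
    apply/setP=> -[i|x]; rewrite !inE //= -/(_ == p).
    have -> : ((inr x : I + T) == inr p) = (x == p) by [].
    by have [->|xp] := eqVneq x p; rewrite ?pR //= andbC.
  apply: (connected_on_image (phi := id)) contract_connected _ _ _ => //.
    by move=> w wN; exists w.
  have h i x : x \notin R -> x \in b i -> x \in b' i.
    by move=> xR xi; rewrite in_collapse ?xi //; apply: contraNneq xR => ->.
  by case=> [i|x] [j|y] //=; rewrite !inE; [move=> _ /andP[yR _] | move=> /andP[xR _] _]; apply: h.
have [zN|zN] := boolP (z \in nodes I U'); last first.
  by have -> : nodes I U' :\ z = nodes I U' by apply/setP=> q; rewrite in_setD1; case: eqP => // ->; rewrite (negPf zN).
apply: (connected_on_image (phi := phi)) (bicon.2 z) _ _ (fun u w _ _ => hom u w) => [q|w].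
  rewrite !in_setD1 => /andP[qz qN]; rewrite phiN // andbT.
  apply: contraNneq qz; case: q qN => [i|x] qN; rewrite /phi; first by move=> ->.
  by case: ifP => [_ pz|_ -> //]; move: zp; rewrite -pz eqxx.
rewrite in_setD1 => /andP[wz wN]; exists w; last exact: phi_id.
by rewrite in_setD1 wz; apply: sub.
Qed.

(** A cycle through the new point p enters it by some b j at a point u' of R and leaves
    it by some b i at a point u of R.  If u = u' is possible, the cycle lifts unchanged.  Otherwise e
    is not on the cycle, because its image is the pair {v1, p} and e contains
    all of R; so e can be inserted between u' and u, which makes the cycle
    longer. *)
Lemma contract_no_long_berge k : 1 < k -> no_long_berge b k -> no_long_berge b' k.
Proof.
move=> k1 nolong s cyc u1 u2; rewrite ltnNge; apply/negP=> ks.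
have Re u : u \in R -> u \in b e by move=> uR; rewrite be setU1r.
have inb x i : x \in b' i -> x != p -> (x \in b i) && (x \notin R).
  by move=> xi xp; move: xi; rewrite in_collapse.
have meet i : p \in b' i -> exists2 u, u \in R & u \in b i.
  by rewrite collapse_pt // -setI_eq0 => /set0Pn[u]; rewrite inE => /andP[ui uR]; exists u.
have [ps|ps] := boolP (p \in map fst s); last first.
  suff : size s < k by rewrite ltnNge ks.
  apply: nolong => //; apply: (sub_in_cycle (P := fun q => q.1 != p)) cyc.
    move=> q q' qp q'p /andP[h1 h2]; have /andP[h1' _] := inb _ _ h1 qp.
    by have /andP[h2' _] := inb _ _ h2 q'p; rewrite /berge_step h1'.
  by apply/allP=> q qs; apply: contraNneq ps => <-; apply: map_f.
case/mapP: ps => -[p' i] ps /= Ep; rewrite -{p'}Ep in ps.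
have [n s' Er] := rot_to ps.
have cyc' : cycle (berge_step b') ((p, i) :: s') by rewrite -Er rot_cycle.
have u1' : uniq (p :: map fst s') by rewrite -[_ :: _]/(map fst ((p, i) :: s')) -Er map_rot rot_uniq.
have u2' : uniq (i :: map snd s') by rewrite -[_ :: _]/(map snd ((p, i) :: s')) -Er map_rot rot_uniq.
have ks' : k <= size ((p, i) :: s') by rewrite -Er size_rot.
have np q : q \in s' -> q.1 != p.
  by move=> qs; case/andP: u1' => + _; apply: contraNneq => <-; apply: map_f.
case: s' Er cyc' u1' u2' ks' np => [|[w j0] s'] _ cyc' u1' u2' ks' np.
  by move: ks'; rewrite leqNgt k1.
have self q : q \in (w, j0) :: s' -> q.1 \in b' q.2.
  by move=> qs; have /andP[] := next_cycle cyc' (mem_behead (s := _ :: _) qs).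
move: cyc'; rewrite /= rcons_path => /and3P[/andP[/= pi wi] pth].
set z := last _ _ => /andP[/= zj pj].
have zs : z \in (w, j0) :: s' by apply: mem_last.
have pth' : path (berge_step b) (w, j0) s'.
  apply: (sub_in_path (P := fun q => q.1 != p)) pth => [q q' qp q'p /andP[h1 h2]|].
    have /andP[h1' _] := inb _ _ h1 qp.
    by have /andP[h2' _] := inb _ _ h2 q'p; rewrite /berge_step h1'.
  exact/allP.
have [wib wR] := andP (inb _ _ wi (np (w, j0) (mem_head _ _))).
have [zjb zR] := andP (inb _ _ zj (np z zs)).
have nR q : q \in (w, j0) :: s' -> q.1 \notin R.
  move=> qs; have qp := np q qs.
  by have /andP[] := inb _ _ (self q qs) qp.
have nRm x : x \in R -> x \notin map fst ((w, j0) :: s').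
  by move=> xR; apply/mapP=> -[q /nR + xq]; rewrite -xq xR.
have [[u uR [ui uj]]|disj] := classic (exists2 u, u \in R & u \in b i /\ u \in b z.2).
  suff : size ((u, i) :: (w, j0) :: s') < k by rewrite ltnNge ks'.
  apply: nolong => //=.
    by rewrite rcons_path pth' /berge_step /= ui wib -/z zjb uj.
  by move: u1'; rewrite -/(map fst (_ :: s')) /= => /andP[_ ->]; rewrite andbT; exact: nRm uR.
have [u uR ui] := meet _ pi; have [u' u'R u'j] := meet _ pj.
have uu' : u' != u.
  by apply/eqP=> uu'; apply: disj; exists u => //; rewrite -{2}uu'.
have ie : i != e.
  by apply: contra_not_neq disj => ie; exists u' => //; rewrite ie Re.
have ze : z.2 != e.
  by apply: contra_not_neq disj => ze; exists u => //; rewrite ze Re.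
have es : e \notin map snd ((w, j0) :: s').
  apply/mapP=> -[q qs eq].
  have only x : x \in b' e -> x != p -> x = v1.
    by move=> xe xp; have /andP[] := inb _ _ xe xp; rewrite be !inE => /orP[/eqP//|->].
  have qv : q.1 = v1 by apply: only (np q qs); rewrite eq self.
  have [s1 [s2 Es]] : exists s1 s2, (w, j0) :: s' = s1 ++ q :: s2.
    by case/splitPr: qs => s1 s2; exists s1, s2.
  case: s2 Es => [|q' s2] Es.
    have zq : z = q by have /(congr1 (last q)) := Es; rewrite last_cat.
    by rewrite zq -eq eqxx in ze.
  have q's : q' \in (w, j0) :: s' by rewrite Es mem_cat !inE eqxx !orbT.
  have : sorted (berge_step b') (s1 ++ q :: q' :: s2) by rewrite -Es.
  case/cat_sorted2=> _ /= /andP[/andP[_ q'e] _].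
  have q'v : q'.1 = v1 by apply: only (np q' q's); rewrite eq.
  have : uniq (map fst ((w, j0) :: s')) by case/andP: u1'.
  by rewrite Es map_cat cat_uniq /= qv q'v !inE eqxx !andbF.
suff : size [:: (u', e), (u, i), (w, j0) & s'] < k by rewrite ltnNge (leq_trans ks').
apply: nolong => //.
- rewrite /= rcons_path pth' /berge_step /= (Re _ u'R) (Re _ uR) ui wib -/z zjb u'j //.
- move: u1'; rewrite /= => /andP[_ u1']; apply/and3P; split=> //; last exact: nRm uR.
  by rewrite inE negb_or uu'; apply: nRm.
move: u2' => /= u2'; apply/andP; split=> //; rewrite inE negb_or eq_sym ie; exact: es.
Qed.
End Contraction.

Section Main.
Variables (T I : finType).
Implicit Types (b : I -> {set T}) (U : {set T}) (F : {set I}).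

Definition shrink b (e : I) (v : T) : I -> {set T} :=
  fun i => if i == e then b e :\ v else b i.

Lemma shrink_sub b e v i : shrink b e v i \subset b i.
Proof. by rewrite /shrink; case: eqP => [->|//]; apply: subsetDl. Qed.

(** If no node separates v, then e and v remain connected after the deletion of v
    from e, also when a further node is removed; so the lost incidence can be
    bypassed in every connectivity statement. *)
Lemma shrink_biconnected b U e v :
    2 < #|b e| -> v \in b e -> v \in U -> biconnected b U ->
    (forall c, ~~ separates b U e v c) -> biconnected (shrink b e v) U.
Proof.
move=> e3 ve vU bicon nsep.
have off (A : {set I + T}) : inl e \notin A -> forall x y, connect (restr (inc b) A) x y ->
    connect (restr (inc (shrink b e v)) A) x y.
  move=> eA x y; apply: connect_sub => p q /and3P[pA qA gpq].
  apply: connect1; apply/and3P; split=> //.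
  have ne i : inl i \in A -> (i == e) = false by move=> iA; apply: contraNF eA => /eqP<-.
  by case: p q pA qA gpq => [i|x0] [j|y0] //= pA qA; rewrite /shrink ne.
have link c : c != inl e -> c != inr v ->
    connect (restr (inc (shrink b e v)) (nodes I U :\ c)) (inl e) (inr v).
  move=> ce cv; have := nsep c; rewrite /separates ce cv /= => /forall_inPn[u ue].
  rewrite negb_imply negbK => /andP[uv cvu].
  have inN : nodes I U :\ inl e :\ c \subset nodes I U :\ c.
    by apply/subsetP=> q; rewrite !in_setD1 => /and3P[-> _ ->].
  have uN : inr u \in nodes I U :\ c.
    by case: (connect_restr_last cvu) => [[uv']|/(subsetP inN) //]; rewrite uv' eqxx in uv.
  rewrite (connect_restr_sym (inc_sym _)).
  apply: (connect_step (y := inr u)) => //; last by rewrite /= /shrink eqxx !inE uv.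
    by apply: connect_restrS inN (off _ _ _ _ cvu); rewrite !in_setD1 eqxx andbF.
  by rewrite in_setD1 eq_sym ce inl_nodes.
have conn (A : {set I + T}) : connected_on (inc b) A ->
    (inl e \in A -> inr v \in A -> connect (restr (inc (shrink b e v)) A) (inl e) (inr v)) ->
    connected_on (inc (shrink b e v)) A.
  move=> connA linkA x y xA yA; have cxy : connect (restr (inc b) A) x y := connA _ _ xA yA.
  apply: connect_sub cxy => p q /and3P[pA qA gpq].
  have sh i t : t \in b i -> (t \in shrink b e v i) || ((i == e) && (t == v)).
    by rewrite /shrink; case: eqP => [->|_] te; rewrite ?te // in_setD1 te andbT; case: eqP.
  case: p q pA qA gpq => [i|t] [j|w] //= pA qA /sh/orP[h|/andP[/eqP ie /eqP tv]].
  - by apply: connect1; apply/and3P.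
  - by move: pA qA; rewrite ie tv; apply: linkA.
  - by apply: connect1; apply/and3P.
  - by rewrite (connect_restr_sym (inc_sym _)); move: pA qA; rewrite ie tv => vA eA; apply: linkA.
split.
  apply: conn bicon.1 _ => _ _.
  have [u] : exists u, u \in b e :\ v.
    by apply/card_gt0P; move: e3; rewrite (cardsD1 v) ve; clear; lia.
  rewrite !inE => /andP[uv _].
  apply: connect_restrS (link (inr u) _ _) => //; first exact: subsetDl.
move=> z; apply: conn (bicon.2 z) _; rewrite !in_setD1 => /andP[ze _] /andP[zv _].
by apply: link; rewrite eq_sym.
Qed.

Lemma antichain_bound_bin r x : 2 * r <= x -> antichain_bound r x = 'C(x, r).
Proof. by move=> rx; rewrite /antichain_bound; congr 'C(_, _); lia. Qed.

Lemma antichain_bound_gap r x i : 1 < r -> 2 * r <= x ->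
  antichain_bound r x + 2 * i <= antichain_bound r (x + i).
Proof.
move=> r2 rx; elim: i => [|i IHi]; first by rewrite muln0 !addn0.
apply: (@leq_trans (antichain_bound r (x + i) + 2)); first by move: IHi; clear; lia.
rewrite [x + i.+1]addnS.
rewrite !antichain_bound_bin; [|lia..].
case: r r2 rx {IHi} => // r r2 rx; rewrite binS leq_add2l.
apply: leq_trans (_ : 'C(x + i, 1) <= _); first by rewrite bin1; lia.
by apply: leq_bin_half; lia.
Qed.

(** Induction on the number of vertices plus the total size of the hyperedges.
    Points are deleted from hyperedges as long as this is possible.  Then either
    all points of hyperedges with at least three points are covered, and the
    shadow graph is handled by [kopylov], or some hyperedge e is contracted: down
    to a pair if at least k vertices remain, where the bound for the same a grows
    by at least 2 for each of the |e| - 2 vertices that disappear, and entirely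
    otherwise, where a = 2 will do. *)
Lemma sperner_hypergraph_bound b U F k r :
    3 <= r -> 4 * r <= k ->
    (forall i, b i \subset U) -> (forall i, #|b i| <= r) ->
    {in F &, forall i j, b i \subset b j -> i = j} ->
    biconnected b U -> no_long_berge b k -> k <= #|U| ->
  exists a, [/\ 2 <= a, a <= k.-1./2 &
    #|F| <= antichain_bound r (k - a) + (#|U| - (k - a)) * antichain_bound r.-1 a].
Proof.
move=> r3 rk.
have [n] := ubnP (#|U| + \sum_i #|b i|); elim: n b U F => // n IHn b U F ltn bU le_r antiF bicon noberge kU.
have U3 : 2 < #|U| by apply: leq_trans kU; clear -r3 rk; lia.
have k5 : 4 < k by clear -r3 rk; lia.
have [[e [v [e3 ve nsep ncov]]]|irred] := classic (exists e v,
    [/\ 2 < #|b e|, v \in b e, forall c, ~~ separates b U e v c & ~ covered b F e v]).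
  apply: (IHn (shrink b e v)) => //.
  - rewrite -ltnS; apply: leq_trans ltn; rewrite ltnS -addnS leq_add2l.
    rewrite (bigD1 e) //= [X in _ <= X](bigD1 e) //= /shrink eqxx (cardsD1 v (b e)) ve.
    rewrite add1n addSn ltnS leq_add2l; apply: leq_sum => i /negPf->; exact: leqnn.
  - by move=> i; apply: subset_trans (shrink_sub _ _ _ _) (bU i).
  - by move=> i; apply: leq_trans (subset_leq_card (shrink_sub _ _ _ _)) (le_r i).
  - move=> i j iF jF; rewrite /shrink; case: (eqVneq i e) => [ie|ie]; case: (eqVneq j e) => [je|je].
    + by rewrite ie je.
    + by move=> sub; case: ncov; split; [rewrite -ie | exists j].
    + by move=> sub; apply: antiF => //; rewrite je; apply: subset_trans sub (subsetDl _ _).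
    + exact: antiF.
  - by apply: shrink_biconnected => //; apply: (subsetP (bU e)).
  - move=> s cyc; apply: noberge; apply: sub_cycle cyc => p q /andP[h1 h2].
    by rewrite /berge_step !(subsetP (shrink_sub b e v p.2)).
have ess_or_cov e v : 2 < #|b e| -> v \in b e ->
    (exists c, separates b U e v c) \/ covered b F e v.
  move=> e3 ve; apply: NNPP => no; apply: irred; exists e, v; split=> //.
    by move=> c; apply/negP=> sc; apply: no; left; exists c.
  by move=> cov; apply: no; right.
have [[e [v0 [e3 v0e ncov]]]|good] := classic (exists e v, [/\ 2 < #|b e|, v \in b e & ~ covered b F e v]); last first.
  have cov i v : 2 < #|b i| -> v \in b i -> i \in F /\ exists j, [/\ j \in F, j != i & b i :\ v \subset b j].
    by move=> i3 vi; apply: NNPP => nc; apply: good; exists i, v.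
  have injF : {in F &, injective b} by move=> i j iF jF eb; apply: antiF => //; rewrite eb.
  rewrite -(card_in_imset injF); apply: (@kopylov _ U k k5 (shadow b)) => //.
  - split.
    + by move=> x y; rewrite /shadow eq_sym; congr (_ && _); apply: eq_existsb => i; rewrite andbC.
    + by move=> x; rewrite /shadow eqxx.
    + by move=> x y /andP[_ /existsP[i /andP[xi _]]]; apply: (subsetP (bU i)).
    + by move=> z; apply: shadow_connected; apply: bicon.2.
  - apply: (shadow_no_long_cycle antiF cov _ noberge); last by clear -k5; lia.
    by move=> i; apply: leq_ltn_trans (le_r i) _; clear -r3 rk; lia.
  - by move=> _ _ /imsetP[i iF ->] /imsetP[j jF ->] /(antiF _ _ iF jF) ->.
  - by move=> _ /imsetP[i iF ->].
  - by move=> _ /imsetP[i iF ->].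
  - by move=> _ /imsetP[i iF ->]; apply: shadow_clique.
have [E [cut cutE]] := cut_system_exists bU bicon antiF e3 (fun v => ess_or_cov e v e3) v0e ncov.
have [Ee sep cutb shape] := cutE.
have mU := subset_leq_card (bU e).
have mr := le_r e.
have [small|large] := ltnP (#|U| - (#|b e| - 2)) k.
  have count := count_full_contraction bU bicon U3 antiF e3 cutE le_r.
  exists 2; split=> //; first by clear -r3 rk; lia.
  have gap : antichain_bound r (#|U| - #|b e|).+1 + 2 * (k - 2 - (#|U| - #|b e|).+1) <=
      antichain_bound r (k - 2).
    have -> : k - 2 = (#|U| - #|b e|).+1 + (k - 2 - (#|U| - #|b e|).+1).
      by clear -small e3 mU; lia.
    rewrite addKn; apply: antichain_bound_gap; first by clear -r3; lia.
    by clear -r3 rk mr kU; lia.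
  have -> : antichain_bound r.-1 2 = 2.
    by rewrite /antichain_bound (_ : minn _ _ = 1) ?bin1 //; clear -r3; lia.
  move: (antichain_bound _ _) (antichain_bound _ _) count gap => x y count gap.
  by clear -count gap small e3 mU kU; lia.
(* v1 is the point of e that is kept apart: the exceptional one if it exists. *)
have [v1 [v1e R_E]] : exists v1, v1 \in b e /\ b e :\ v1 \subset E.
  case: shape => [->|[a [j [ae sub _ _]]]]; last by exists a.
  by exists v0; split=> //; apply: subsetDl.
pose R := b e :\ v1.
have be : b e = v1 |: R by rewrite setD1K.
have v1R : v1 \notin R by rewrite !inE eqxx.
have cardR : #|b e| = #|R|.+1 by rewrite (cardsD1 v1) v1e.
have [p pR] : exists p, p \in R by apply/card_gt0P; move: e3; rewrite cardR; clear; lia.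
have Re u : u \in R -> u \in b e by move=> uR; rewrite be setU1r.
have sepR v : v \in R -> separates b U e v (cut v) by move=> vR; apply: sep; apply: (subsetP R_E).
have cutR u v : v \in R -> u \in b e -> cut v != inr u by move=> vR; apply: cutb; apply: (subsetP R_E).
pose L := \bigcup_(v in R) lost b F cut v.
have cardL : #|L| <= #|R| by apply: card_all_lost.
pose b' i := collapse R p (b i); pose U' := U :\: (R :\ p).
have cardU : #|U'| = #|U| - (#|b e| - 2).
  rewrite cardsDS; last by apply: subset_trans (subsetDl _ _) (subset_trans (subsetDl _ _) (bU e)).
  by rewrite cardR (cardsD1 p R) pR; clear; lia.
have [|||||||a [a2 at_ leF']] := IHn b' U' (F :\: L).
- apply: leq_trans (_ : #|U'|.+1 + \sum_i #|b i| <= _).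
    by rewrite addSn ltnS leq_add2l; apply: leq_sum => i _; apply: collapse_card.
  apply: leq_trans (_ : #|U| + \sum_i #|b i| <= _); last by rewrite -ltnS.
  by rewrite leq_add2r cardU; clear -e3 mU; lia.
- by move=> i; apply: collapse_sub => //; apply: (subsetP (bU e)); apply: Re.
- by move=> i; apply: leq_trans (collapse_card _ _ _) (le_r i).
- have inL v h : v \in R -> h \in lost b F cut v -> h \in L by move=> vR hl; apply/bigcupP; exists v.
  move=> g g'; rewrite !in_setD => /andP[gL gF] /andP[g'L g'F] /(collapse_subset pR)[sub1 sub2].
  have [ge|ge] := eqVneq g e.
    apply/eqP/negPn/negP=> gg'; have g'e : g' != e by rewrite -ge eq_sym.
    have v1g' : v1 \in b g' by apply: sub1; rewrite // ge.
    have [u ug' uR] := sub2 p ltac:(by rewrite ge Re) pR.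
    have v1u : v1 != u by apply: contraNneq v1R => ->.
    case: (separates_edge bU (sepR u uR) v1e v1u ug' v1g' g'e) => cu.
      by case/negP: g'L; apply: (inL u) => //; rewrite inE g'F cu eqxx.
    by have := cutR v1 u uR v1e; rewrite cu eqxx.
  have [g'e|g'e] := eqVneq g' e.
    apply: antiF => //; apply/subsetP=> y yg; have [yR|yR] := boolP (y \in R).
      by rewrite g'e Re.
    exact: sub1.
  apply: antiF => //; apply/subsetP=> x xg; apply/negPn/negP=> xg'.
  have xR : x \in R by apply/negPn/negP=> /(sub1 _ xg); rewrite (negPf xg').
  have [u ug' uR] := sub2 x xg xR.
  have sub y : y \in b g -> y \notin b e -> y \in b g'.
    by move=> yg ye; apply: sub1 => //; apply: contra ye; apply: Re.
  have xE : x \in E by apply: (subsetP R_E).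
  case/orP: (collision bU bicon U3 cutE xE gF g'F ge g'e xg xg' ug' (Re u uR) sub) => /(inL _ _ xR).
    by rewrite (negPf gL).
  by rewrite (negPf g'L).
- exact: contract_biconnected bU bicon be v1R pR sepR cutR.
- by apply: contract_no_long_berge be pR _ _ _ => //; clear -k5; lia.
- by rewrite cardU.
exists a; split=> //.
have leF : #|F| <= #|F :\: L| + #|R|.
  by rewrite -(cardsID L F) addnC leq_add2l (leq_trans _ cardL) // subset_leq_card // subsetIr.
have ga : 2 <= antichain_bound r.-1 a.
  apply: leq_trans (leq_antichain_bound r.-1 a2).
  by rewrite /antichain_bound (_ : minn _ _ = 1) ?bin1 //; clear -r3; lia.
apply: leq_trans leF _; apply: leq_trans (leq_add leF' (leqnn _)) _.
rewrite cardU -addnA leq_add2l.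
have -> : #|U| - (k - a) = (#|U| - (#|b e| - 2) - (k - a)) + (#|R| - 1).
  by clear -large e3 mU cardR; lia.
rewrite mulnDl leq_add2l.
have : 1 < #|R| by move: e3; rewrite cardR.
move: #|R| (antichain_bound _ _) ga => x y; clear; nia.
Qed.
End Main.

(** * Convexity of the bound *)

(** Pascal's rule; if x is odd, the optimal size may move from (x - 1)/2 to
    (x + 1)/2, and C(x, _) takes the same value at both. *)
Lemma antichain_boundS_diff s x : 0 < s -> 0 < x ->
  antichain_bound s x.+1 = antichain_bound s x + 'C(x, (minn s x.+1./2).-1).
Proof.
move=> s0 x0; rewrite /antichain_bound.
have [M EM] : exists M, minn s x.+1./2 = M.+1.
  exists (minn s x.+1./2).-1; lia.
rewrite EM binS; congr (_ + _).
have [->//|ne] := eqVneq (minn s x./2) M.+1.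
rewrite -bin_sub; last by lia.
by congr 'C(_, _); lia.
Qed.

Definition convex_on (h : nat -> nat) (u v : nat) : Prop :=
  forall a, u <= a -> a + 2 <= v -> 2 * h a.+1 <= h a + h a.+2.

(** From the first increase on, a convex sequence does not decrease any more, so
    its largest value is at one of the two ends. *)
Lemma convex_max h u v a : convex_on h u v -> u <= a -> a <= v -> h a <= maxn (h u) (h v).
Proof.
move=> cvx ua av.
have up c d : u <= c -> c + d.+1 <= v -> h c <= h c.+1 -> h (c + d) <= h (c + d).+1.
  move=> uc; elim: d => [|d IHd] cv hc; first by rewrite addn0.
  have {}IHd := IHd ltac:(lia) hc; have := cvx (c + d) ltac:(lia) ltac:(lia).
  by rewrite addnS; lia.
have up' c d : u <= c -> c + d <= v -> h c <= h c.+1 -> h c <= h (c + d).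
  move=> uc; elim: d => [|d IHd] cv hc; first by rewrite addn0.
  have := IHd ltac:(lia) hc; have := up c d uc ltac:(lia) hc; rewrite addnS; lia.
suff [le|le] : h a <= h u \/ h a <= h v by rewrite leq_max le ?orbT.
have [d Ea] : exists d, a = u + d by exists (a - u); lia.
elim: d a ua av Ea => [|d IHd] a ua av Ea; first by left; rewrite Ea addn0.
have [le1|lt1] := leqP (h (u + d)) (h (u + d).+1).
  have [->|ltav] : a = v \/ a < v by lia.
    by right.
  right; have := up (u + d) 1 ltac:(lia) ltac:(lia) le1; rewrite addn1 => le2.
  have := up' a (v - a) ua ltac:(lia); rewrite Ea addnS => /(_ le2).
  by rewrite -addnS -Ea subnKC //.
have := up' (u + d); case: (IHd (u + d)); [lia | lia | by [] | |].
  by left; rewrite Ea addnS; lia.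
move=> le _; by right; rewrite Ea addnS; lia.
Qed.

Lemma convex_antichain_bound s x : 0 < s -> 0 < x ->
  2 * antichain_bound s x.+1 <= antichain_bound s x + antichain_bound s x.+2.
Proof.
move=> s0 x0; rewrite (antichain_boundS_diff s0 (ltn0Sn x)) (antichain_boundS_diff s0 x0).
suff : 'C(x, (minn s x.+1./2).-1) <= 'C(x.+1, (minn s x.+2./2).-1) by lia.
apply: (@leq_trans 'C(x.+1, (minn s x.+1./2).-1)); first by apply: leq_bin2l.
by apply: leq_bin_half; lia.
Qed.

Lemma convex_bin r x : 0 < r -> 2 * 'C(x.+1, r) <= 'C(x, r) + 'C(x.+2, r).
Proof.
case: r => // r _; rewrite !binS.
have : 'C(x, r) <= 'C(x.+1, r) by apply: leq_bin2l.
by lia.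
Qed.

Definition nat_f (n k r a : nat) : nat :=
  antichain_bound r (k - a) + (n - (k - a)) * antichain_bound r.-1 a.

Lemma nat_fE n k r a : 0 < r -> a <= k -> k <= n + a -> f n k r a = (nat_f n k r a)%:Z%R.
Proof.
move=> r0 ak kn; rewrite /f /nat_f PoszD PoszM /antichain_bound subn1; congr (_ + _ * _)%R.
by lia.
Qed.

(** The first term of the bound is convex because C(_, r) is; the second one is
    the product of a nonnegative increasing linear function and a nondecreasing
    convex one. *)
Lemma convex_nat_f n k r : 3 <= r -> 4 * r <= k -> k <= n ->
  convex_on (nat_f n k r) 2 k.-1./2.
Proof.
move=> r3 rk kn a a2 av; rewrite /nat_f.
have [x Ex] : exists x, k - a = x.+2 by exists (k - a).-2; lia.
have [w Ew] : exists w, n - (k - a) = w by eexists.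
have -> : k - a.+1 = x.+1 by lia.
have -> : k - a.+2 = x by lia.
have -> : n - x.+1 = w.+1 by lia.
have -> : n - x = w.+2 by lia.
rewrite Ew Ex !(@antichain_bound_bin r); [|lia..].
have r0 : 0 < r by lia.
have r'0 : 0 < r.-1 by lia.
have a0 : 0 < a by lia.
have h1 := convex_bin x r0.
have h2 := convex_antichain_bound r'0 a0.
have h3 := antichain_boundS r.-1 a; have h4 := antichain_boundS r.-1 a.+1.
move: h1 h2 h3 h4; clear.
move: (antichain_bound _ _) (antichain_bound _ _) (antichain_bound _ _) => p q s.
move: 'C(_, _) 'C(_, _) 'C(_, _) => p' q' s'.
nia.
Qed.

(** * The theorem *)

Lemma berge_cycle_of_seq (T : finType) (H : {set {set T}}) (s : seq (T * {e : {set T} | e \in H})) :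
    0 < size s -> cycle (berge_step (fun e => val e)) s ->
    uniq (map fst s) -> uniq (map snd s) ->
  has_berge_cycle H (size s).
Proof.
case: s => // x0 s _ cyc u1 u2; set s0 := x0 :: s.
exists (fun i => (nth x0 s0 i).1), (fun i => val (nth x0 s0 i).2); split.
- move=> i j /eqP; rewrite -!(nth_map x0 x0.1 fst) ?ltn_ord // nth_uniq ?size_map ?ltn_ord //.
  by move/eqP/val_inj.
- move=> i j /val_inj/eqP; rewrite -!(nth_map x0 x0.2 snd) ?ltn_ord // nth_uniq ?size_map ?ltn_ord //.
  by move/eqP/val_inj.
- by move=> i; apply: valP.
move=> i; have := pathP x0 cyc i; rewrite size_rcons ltn_ord => /(_ isT)/andP[].
rewrite -rcons_cons nth_rcons ltn_ord => h1 h2.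
apply/subsetP=> y; rewrite !inE => /orP[/eqP->//|/eqP->].
have -> : nth x0 s0 (ordS i) = nth x0 (rcons s x0) i; last by [].
have := ltn_ord i; rewrite /= ltnS leq_eqVlt nth_rcons => /orP[/eqP->|lt].
  by rewrite ltnn eqxx modnn.
by rewrite lt modn_small.
Qed.

Local Open Scope ring_scope.

Theorem theorem2p3 (n k r n_kr : nat) (T : finType) (H : {set {set T}})
    (n_krP : is_n_kr k r n_kr)
    (le_nkr_n : (n_kr <= n)%N)
    (le_k_nkr : (k <= n_kr)%N)
    (le_4r_k : (4 * r <= k)%N)
    (le_12_4r : (12 <= 4 * r)%N)
    (cardT : #|T| = n)
    (H2conn : two_connected H)
    (Hunif : uniform r H)
    (Hnocycle : forall l : nat, (k <= l)%N -> ~ has_berge_cycle H l) :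
  #|H|%:Z <= f n k r (k - 1)./2
  /\ f n k r (k - 1)./2 = fstar n k r (k - 1)./2.
Proof.
have r3 : (3 <= r)%N by lia.
have r0 : (0 < r)%N by lia.
have le_kn : (k <= n)%N by apply: leq_trans le_k_nkr le_nkr_n.
rewrite subn1; set t := k.-1./2.
have t2 : (2 <= t)%N by rewrite /t; lia.
have tk : (t <= k)%N by rewrite /t; lia.
split; last first.
  rewrite /f /fstar; congr (_%:Z + _ * _%:Z); congr 'C(_, _); rewrite /t; lia.
pose I : finType := {e : {set T} | e \in H}.
pose b (e : I) : {set T} := val e.
have HI : #|[set: I]| = #|H| by rewrite cardsT card_sig; apply: eq_card.
have [a [a2 at_]] : exists a, [/\ 2 <= a, a <= t & #|H| <= nat_f n k r a]%N.
  have [] := @sperner_hypergraph_bound T I b [set: T] [set: I] k r r3 le_4r_k.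
  - by move=> i; apply: subsetT.
  - by move=> i; rewrite /b (Hunif _ (valP i)).
  - move=> i j _ _ sij; apply: val_inj; apply/eqP; rewrite eqEcard sij.
    by rewrite (Hunif _ (valP i)) (Hunif _ (valP j)) leqnn.
  - have nT : nodes I [set: T] = setT by apply/setP=> -[i|x]; rewrite !inE.
    have [_ conn] := H2conn; split=> [|z]; rewrite nT.
      by rewrite -setC0; apply: conn; rewrite cards0.
    have -> : [set: I + T] :\ z = ~: [set z] by apply/setP=> q; rewrite !inE andbT.
    by apply: conn; rewrite cards1.
  - move=> s cyc u1 u2; rewrite ltnNge; apply/negP=> ks.
    apply: (Hnocycle _ ks); apply: berge_cycle_of_seq => //.
    by apply: leq_trans ks; lia.
  - by rewrite cardsT cardT.
  by move=> a; rewrite HI cardsT cardT => -[a2 at_ le]; exists a.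
move=> leH.
have le2t : (nat_f n k r 2 <= nat_f n k r t)%N.
  have [_ + _] := n_krP; rewrite subn1 -/t !nat_fE //; [|lia..].
  rewrite lez_nat /nat_f.
  have g2 := leq_antichain_bound r.-1 t2.
  have [d ->] : exists d, n = (n_kr + d)%N by exists (n - n_kr)%N; lia.
  have -> : (n_kr + d - (k - 2) = n_kr - (k - 2) + d)%N by lia.
  have -> : (n_kr + d - (k - t) = n_kr - (k - t) + d)%N by lia.
  rewrite !mulnDl !addnA => h; apply: leq_add h _.
  by rewrite leq_mul2l g2 orbT.
rewrite nat_fE //; last by lia.
rewrite lez_nat; apply: leq_trans leH _.
apply: leq_trans (convex_max (convex_nat_f r3 le_4r_k le_kn) a2 at_) _.
by rewrite -/t geq_max le2t leqnn.
Qed.
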